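(* Let $k$ be a separated complete linearly topologized ring which has a countable basis of open ideals and is clop, and let $M\in\mathcal{CLM}_k^u$. (1) The surjective morphism $\sigma_M:\widehat M\to M$ factors as $\widehat M\to M^{\max}\to M^{\mathrm{barrell}}\to M$, where the first map is the canonical map to the coimage of $\sigma_M$, the remaining maps are bijective morphisms of $\mathcal{CLM}_k^u$ (inducing the identity on the underlying $k$-module), and the three topologies $M^{\mathrm{barrell}}$, $M^{\mathrm{clop}}$, $M^{\mathrm{pscan}}$ on the underlying $k$-module of $M$ coincide. (2) If moreover $k$ is fop and has a countable basis of open ideals, then the map $\widehat M\to M^{\max}$ is an isomorphism and $M^{\max}$ is the underlying $k$-module of $M$ with its naive canonical topology; in particular this $k$-module is complete in its naive canonical topology, there are bijective morphisms $M^{\mathrm{naive}}=M^{\max}\to M^{\mathrm{barrell}}=M^{\mathrm{clop}}=M^{\mathrm{pscan}}\to M$, and the naive canonical topology is the unique maximal structure of an object of $\mathcal{CLM}_k^u$ on the underlying $k$-module of $M$.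
   Context: All rings are commutative with $1$. A linearly topologized ring $k$ is a ring with a group topology having a basis of neighbourhoods of $0$ consisting of ideals; $\mathcal P(k)$ is the set of open ideals. $k$ is clop if for all $I,J\in\mathcal P(k)$ the closure of $IJ$ is open; $k$ is fop if for all $I,J\in\mathcal P(k)$ the ideal $IJ$ is open and every open ideal contains a finitely generated open ideal. A linearly topologized $k$-module is a $k$-module with a group topology having a basis of neighbourhoods of $0$ of $k$-submodules, each $m\mapsto am$ continuous; it is uniform if for every open submodule $P$ there is $I\in\mathcal P(k)$ with $IM\subseteq P$. $\mathcal{CLM}_k^u$ is the category of separated complete uniform linearly topologized $k$-modules with continuous $k$-linear maps. The naive canonical topology on a $k$-module $N$ is the one with basis of open submodules $\{IN: I\in\mathcal P(k)\}$; $M^{\mathrm{naive}}$ is the underlying module of $M$ with this topology. $\widehat M$ is the separated completion of $M^{\mathrm{naive}}$, and $\sigma_M:\widehat M\to M$ is the continuous extension of the identity of $M$. $M^{\max}$ is the coimage of $\sigma_M$ in $\mathcal{CLM}_k^u$ (the separated completion of $\widehat M/\ker\sigma_M$ with the quotient topology). On the underlying $k$-module of $M$, with closures $\overline{\ \cdot\ }$ taken in $M$: $M^{\mathrm{pscan}}$ has basis of open submodules $\{\overline{IM}: I\in\mathcal P(k)\}$; $M^{\mathrm{clop}}$ has basis $\{\overline{JP}: J\in\mathcal P(k), P \text{ open submodule of } M\}$; $M^{\mathrm{barrell}}$ has basis the closed $k$-submodules of $M$ that are sponges, where a subset $P$ is a sponge if for every $m\in M$ there is $I\in\mathcal P(k)$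 with $Im\subseteq P$. *)

(* Defs.v *)
From HB Require Import structures.
From mathcomp Require Import all_boot all_algebra.
From mathcomp Require Import boolp classical_sets functions filter.
From mathcomp Require Import topology.

Set Implicit Arguments.
Unset Strict Implicit.
Unset Printing Implicit Defensive.

Import GRing.Theory.
Local Open Scope classical_set_scope.
Local Open Scope ring_scope.

(* The library's joins of a topology with an lmodType require a numDomainType
   of scalars, so they cannot carry modules over an arbitrary topological
   ring; topological groups are therefore built directly on Topological and
   Zmodule. *)
HB.mixin Record isTopologicalGroup G & Topological G & GRing.Zmodule G := {
  addr_continuous : continuous (fun x : G * G => x.1 + x.2);
  oppr_continuous : continuous (-%R : G -> G)
}.

#[short(type="topGroupType")]
HB.structure Definition TopGroup :=
  {G of Topological G & GRing.Zmodule G & isTopologicalGroup G}.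

Definition submodule (k : pzRingType) (M : lmodType k) (P : set M) : Prop :=
  [/\ P 0, forall x y, P x -> P y -> P (x + y)
    & forall (a : k) x, P x -> P (a *: x)].

Definition ideal (k : pzRingType) (I : set k) : Prop := @submodule k k^o I.

HB.mixin Record isLinearlyTopologizedRing k
    & TopGroup k & GRing.ComPzRing k := {
  nbhs0_ideal : forall U : set k, nbhs (0 : k) U ->
    exists I : set k, [/\ ideal I, nbhs (0 : k) I & I `<=` U]
}.

#[short(type="linTopRingType")]
HB.structure Definition LinTopRing :=
  {k of TopGroup k & GRing.ComPzRing k & isLinearlyTopologizedRing k}.

HB.mixin Record isLinearlyTopologizedModule (k : linTopRingType) M
    & TopGroup M & GRing.Lmodule k M := {
  scaler_continuous : forall a : k, continuous (fun m : M => a *: m);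
  nbhs0_submodule : forall U : set M, nbhs (0 : M) U ->
    exists P : set M, [/\ submodule P, nbhs (0 : M) P & P `<=` U]
}.

#[short(type="linTopModType")]
HB.structure Definition LinTopMod (k : linTopRingType) :=
  {M of TopGroup M & GRing.Lmodule k M & isLinearlyTopologizedModule k M}.

Section submodules.
Context (k : pzRingType) (M : lmodType k).
Implicit Types P Q : set M.

Lemma submodule0 P : submodule P -> P 0. Proof. by case. Qed.

Lemma submoduleD P x y : submodule P -> P x -> P y -> P (x + y).
Proof. by case=> _ + _; apply. Qed.

Lemma submoduleZ P a x : submodule P -> P x -> P (a *: x).
Proof. by case=> _ _; apply. Qed.

Lemma submoduleN P x : submodule P -> P x -> P (- x).
Proof. by move=> sP Px; rewrite -scaleN1r; apply: submoduleZ. Qed.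

Lemma submoduleB P x y : submodule P -> P x -> P y -> P (x - y).
Proof. by move=> sP Px Py; apply: submoduleD => //; apply: submoduleN. Qed.

Lemma submodule_setT : submodule [set: M]. Proof. by []. Qed.

Lemma submoduleI P Q : submodule P -> submodule Q -> submodule (P `&` Q).
Proof.
move=> sP sQ; split; first by split; apply: submodule0.
  by move=> x y [Px Qx] [Py Qy]; split; apply: submoduleD.
by move=> a x [Px Qx]; split; apply: submoduleZ.
Qed.

Definition submodule_gen (S : set M) : set M := smallest (@submodule k M) S.

Lemma submodule_gen_submodule S : submodule (submodule_gen S).
Proof.
split; first by move=> P [sP _]; apply: submodule0.
  by move=> x y Sx Sy P PS; apply: submoduleD PS.1 _ _; [apply: Sx|apply: Sy].
by move=> a x Sx P PS; apply: submoduleZ PS.1 _; apply: Sx.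
Qed.

Definition ideal_smul (I : set k) (P : set M) : set M :=
  submodule_gen [set a *: m | a in I & m in P].

Lemma ideal_smulS (I J : set k) P Q :
  I `<=` J -> P `<=` Q -> ideal_smul I P `<=` ideal_smul J Q.
Proof.
move=> IJ PQ x IPx R [sR JQR]; apply: IPx; split=> // _ [a Ia [m Pm <-]].
by apply: JQR; exists a; [exact: IJ|exists m; [exact: PQ|]].
Qed.

End submodules.

Definition ideal_gen (k : pzRingType) (S : set k) : set k :=
  @submodule_gen k k^o S.

Definition ideal_mul (k : pzRingType) (I J : set k) : set k :=
  @ideal_smul k k^o I J.

Section linear_topologies.
Context (k : pzRingType) (M : lmodType k).

(* A linear topology on M, presented by a basis of open submodules: a filter
   base of submodules. Every linear topology arises so, e.g. from all its open
   submodules. [topmod B] is M itself, equipped with that topology. *)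
Record submod_basis := SubmodBasis {
  basis_sets :> set (set M);
  basis_submodule : forall P, basis_sets P -> submodule P;
  basis_nonempty : basis_sets !=set0;
  basis_directed : forall P Q, basis_sets P -> basis_sets Q ->
    exists2 R, basis_sets R & R `<=` P `&` Q
}.

Definition topmod (B : submod_basis) : Type := M.

Context (B : submod_basis).

HB.instance Definition _ := GRing.Lmodule.copy (topmod B) M.

HB.instance Definition _ := hasNbhs.Build (topmod B)
  (fun x => filter_from B (fun P => [set y | P (y - x)])).

Lemma topmod_filter (x : topmod B) : ProperFilter (nbhs x).
Proof.
apply: filter_from_proper => [|P BP]; last first.
  by exists x; rewrite /= subrr; apply: submodule0 (basis_submodule BP).
apply: filter_from_filter; first exact: basis_nonempty.
move=> P Q BP BQ; have [R BR RPQ] := basis_directed BP BQ.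
by exists R => // y /RPQ.
Qed.

Lemma topmod_singleton (x : topmod B) A : nbhs x A -> A x.
Proof.
case=> P BP; apply; rewrite /= subrr.
exact: submodule0 (basis_submodule BP).
Qed.

Lemma topmod_nbhs (x : topmod B) A : nbhs x A -> nbhs x (nbhs^~ A).
Proof.
case=> P BP PA; exists P => // y Py; exists P => // z Pz; apply: PA => /=.
rewrite -(subrK y z) -addrA.
exact: (submoduleD (basis_submodule BP) Pz Py).
Qed.

HB.instance Definition _ := Nbhs_isNbhsTopological.Build (topmod B)
  topmod_filter topmod_singleton topmod_nbhs.

Lemma topmod_add : continuous (fun x : topmod B * topmod B => x.1 + x.2).
Proof.
move=> [x y] A [P BP PA].
exists ([set z | P (z - x)], [set z | P (z - y)]); first by split; exists P.
move=> [u v] [/= Pu Pv]; apply: PA => /=; rewrite opprD addrACA.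
exact: (submoduleD (basis_submodule BP) Pu Pv).
Qed.

Lemma topmod_opp : continuous (-%R : topmod B -> topmod B).
Proof.
move=> x A [P BP PA]; exists P => // y Py; apply: PA => /=.
rewrite opprK addrC -opprB.
exact: (submoduleN (basis_submodule BP) Py).
Qed.

HB.instance Definition _ :=
  isTopologicalGroup.Build (topmod B) topmod_add topmod_opp.

End linear_topologies.

Section linear_topologies2.
Context (k : linTopRingType) (M : lmodType k) (B : submod_basis M).

Lemma topmod_scale (a : k) : continuous (fun m : topmod B => a *: m).
Proof.
move=> x A [P BP PA]; exists P => // y Py; apply: PA => /=.
rewrite -scalerBr; exact: (submoduleZ a (basis_submodule BP) Py).
Qed.

Lemma topmod_nbhs0 (U : set (topmod B)) : nbhs (0 : topmod B) U ->
  exists P : set (topmod B), [/\ submodule P, nbhs (0 : topmod B) P & P `<=` U].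
Proof.
case=> P BP PU; exists P; split.
- exact: (basis_submodule BP).
- by exists P => // y /=; rewrite subr0.
- by move=> x Px; apply: PU; rewrite /= subr0.
Qed.

HB.instance Definition _ := isLinearlyTopologizedModule.Build k (topmod B)
  topmod_scale topmod_nbhs0.

End linear_topologies2.

Section properties.

Definition cauchy_filter (G : topGroupType) (F : set_system G) : Prop :=
  forall U : set G, nbhs (0 : G) U ->
    exists2 A, F A & forall x y, A x -> A y -> U (x - y).

(* Completeness does not include separatedness. *)
Definition group_complete (G : topGroupType) : Prop :=
  forall F : set_system G, ProperFilter F -> cauchy_filter F ->
    exists x : G, F --> x.

Context (k : linTopRingType).

Definition open_ideal (I : set k) : Prop := ideal I /\ open I.

Definition countable_ideal_basis : Prop :=
  exists2 u : nat -> set k, forall n, open_ideal (u n) &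
    forall I, open_ideal I -> exists n, u n `<=` I.

Definition clop : Prop :=
  forall I J, open_ideal I -> open_ideal J -> open (closure (ideal_mul I J)).

Definition finitely_generated (I : set k) : Prop :=
  exists s : seq k, I = ideal_gen [set` s].

Definition fop : Prop :=
  (forall I J, open_ideal I -> open_ideal J -> open (ideal_mul I J)) /\
  (forall I, open_ideal I ->
     exists J, [/\ open_ideal J, finitely_generated J & J `<=` I]).

Context (M : linTopModType k).

Definition open_submodule (P : set M) : Prop := submodule P /\ open P.

Definition uniform_module : Prop := forall P, open_submodule P ->
  exists2 I, open_ideal I & ideal_smul I [set: M] `<=` P.

Definition clmu : Prop :=
  [/\ hausdorff_space M, group_complete M & uniform_module].

Definition sponge (P : set M) : Prop :=
  forall m : M, exists2 I, open_ideal I & forall a, I a -> P (a *: m).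

End properties.

Section module_topologies.
Context (k : linTopRingType).

Lemma open_ideal_setT : open_ideal [set: k].
Proof. by split; [exact: submodule_setT|exact: openT]. Qed.

Lemma open_idealI (I J : set k) :
  open_ideal I -> open_ideal J -> open_ideal (I `&` J).
Proof.
by move=> [iI oI] [iJ oJ]; split; [exact: (@submoduleI k k^o)|exact: openI].
Qed.

Section naive.
Context (N : lmodType k).

Definition naive_sets : set (set N) :=
  [set ideal_smul I [set: N] | I in open_ideal (k := k)].

Lemma naive_sets_submodule P : naive_sets P -> submodule P.
Proof. by case=> I _ <-; exact: submodule_gen_submodule. Qed.

Lemma naive_sets_nonempty : naive_sets !=set0.
Proof. by eexists; exists setT => //; exact: open_ideal_setT. Qed.

Lemma naive_sets_directed P Q : naive_sets P -> naive_sets Q ->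
  exists2 R, naive_sets R & R `<=` P `&` Q.
Proof.
move=> [I oI <-] [J oJ <-]; exists (ideal_smul (I `&` J) [set: N]).
  by exists (I `&` J) => //; exact: open_idealI.
by move=> x IJx; split; apply: ideal_smulS IJx => // ? [].
Qed.

Definition naive_basis : submod_basis N :=
  SubmodBasis naive_sets_submodule naive_sets_nonempty naive_sets_directed.

End naive.

Context (M : linTopModType k).
Implicit Types P Q : set M.

Lemma open_submodule_setT : open_submodule [set: M].
Proof. by split; [exact: submodule_setT|exact: openT]. Qed.

Lemma open_submoduleI P Q :
  open_submodule P -> open_submodule Q -> open_submodule (P `&` Q).
Proof. by move=> [? ?] [? ?]; split; [exact: submoduleI|exact: openI]. Qed.

Lemma closure_submodule P : submodule P -> submodule (closure P).
Proof.
move=> sP; split; first by apply: subset_closure; exact: submodule0.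
- move=> x y cx cy A /(addr_continuous (x, y))[[U V] /= [xU yV] UVA].
  have [u [Pu Uu]] := cx _ xU; have [v [Pv Vv]] := cy _ yV.
  by exists (u + v); split; [exact: submoduleD|exact: (UVA (u, v))].
- move=> a x cx A /(scaler_continuous a x) /cx[u [Pu Au]].
  by exists (a *: u); split; [exact: submoduleZ|].
Qed.

Lemma nbhs0_open_submodule (U : set M) : nbhs (0 : M) U ->
  exists2 P, open_submodule P & P `<=` U.
Proof.
move=> /nbhs0_submodule[P [sP P0 PU]]; exists P => //; split=> //.
rewrite openE => x Px; rewrite /interior.
have /(@addr_continuous M (x, - x))[[V W] /= [xV /nbhs_singleton xW] VWP] :
  nbhs (x - x) P by rewrite subrr.
apply: filterS xV => y Vy; rewrite -(subrK x y).
by apply: submoduleD => //; exact: (VWP (y, - x)).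
Qed.

Section pscan.

Definition pscan_sets : set (set M) :=
  [set closure (ideal_smul I [set: M]) | I in open_ideal (k := k)].

Lemma pscan_sets_submodule P : pscan_sets P -> submodule P.
Proof.
by case=> I _ <-; apply: closure_submodule; exact: submodule_gen_submodule.
Qed.

Lemma pscan_sets_nonempty : pscan_sets !=set0.
Proof. by eexists; exists setT => //; exact: open_ideal_setT. Qed.

Lemma pscan_sets_directed P Q : pscan_sets P -> pscan_sets Q ->
  exists2 R, pscan_sets R & R `<=` P `&` Q.
Proof.
move=> [I oI <-] [J oJ <-].
exists (closure (ideal_smul (I `&` J) [set: M])).
  by exists (I `&` J) => //; exact: open_idealI.
by move=> x IJx; split; apply: closureS IJx => y; apply: ideal_smulS => // ? [].
Qed.

Definition pscan_basis : submod_basis M :=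
  SubmodBasis pscan_sets_submodule pscan_sets_nonempty pscan_sets_directed.

End pscan.

Section clop.

Definition clop_sets : set (set M) :=
  [set closure (ideal_smul J P) | J in open_ideal (k := k)
                                & P in open_submodule (M := M)].

Lemma clop_sets_submodule P : clop_sets P -> submodule P.
Proof.
move=> [J _ [Q _ <-]]; apply: closure_submodule.
exact: submodule_gen_submodule.
Qed.

Lemma clop_sets_nonempty : clop_sets !=set0.
Proof.
eexists; exists setT; first exact: open_ideal_setT.
by exists setT => //; exact: open_submodule_setT.
Qed.

Lemma clop_sets_directed P Q : clop_sets P -> clop_sets Q ->
  exists2 R, clop_sets R & R `<=` P `&` Q.
Proof.
move=> [I oI [P' oP <-]] [J oJ [Q' oQ <-]].
exists (closure (ideal_smul (I `&` J) (P' `&` Q'))).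
  exists (I `&` J); first exact: open_idealI.
  by exists (P' `&` Q') => //; exact: open_submoduleI.
by move=> x IJx; split; apply: closureS IJx => y; apply: ideal_smulS => ? [].
Qed.

Definition clop_basis : submod_basis M :=
  SubmodBasis clop_sets_submodule clop_sets_nonempty clop_sets_directed.

End clop.

Section barrell.

Definition barrell_sets : set (set M) :=
  [set P : set M | [/\ submodule P, closed P & sponge P]].

Lemma barrell_sets_submodule P : barrell_sets P -> submodule P.
Proof. by case. Qed.

Lemma barrell_sets_nonempty : barrell_sets !=set0.
Proof.
exists setT; split; [exact: submodule_setT|exact: closedT|].
by move=> m; exists setT => //; exact: open_ideal_setT.
Qed.

Lemma barrell_sets_directed P Q : barrell_sets P -> barrell_sets Q ->
  exists2 R, barrell_sets R & R `<=` P `&` Q.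
Proof.
move=> [sP cP spP] [sQ cQ spQ]; exists (P `&` Q) => //; split.
- exact: submoduleI.
- exact: closedI.
- move=> m; have [I oI IP] := spP m; have [J oJ JQ] := spQ m.
  exists (I `&` J); first exact: open_idealI.
  by move=> a [Ia Ja]; split; [exact: IP|exact: JQ].
Qed.

Definition barrell_basis : submod_basis M := SubmodBasis
  barrell_sets_submodule barrell_sets_nonempty barrell_sets_directed.

End barrell.

End module_topologies.

Notation naive N := (topmod (naive_basis N)).
Notation barrell M := (topmod (barrell_basis M)).

Record submod (k : pzRingType) (N : lmodType k) := Submod {
  submod_set : set N;
  submodP : submodule submod_set
}.

Section submod_pred.
Context (k : pzRingType) (N : lmodType k) (K : submod N).

Definition submod_pred : {pred N} := [pred x | `[< submod_set K x >]].

Lemma submod_pred_closed : GRing.subsemimod_closed submod_pred.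
Proof.
have sK := submodP K; split; first split.
- by apply/asboolP; exact: submodule0.
- by move=> x y /asboolP Kx /asboolP Ky; apply/asboolP; exact: submoduleD.
- by move=> a x /asboolP Kx; apply/asboolP; exact: submoduleZ.
Qed.

HB.instance Definition _ :=
  GRing.isSubmodClosed.Build k N submod_pred submod_pred_closed.

End submod_pred.

Section submodule_type.
Context (k : pzRingType) (N : lmodType k) (K : submod N).

Record submodType := SubmodElt {
  submod_val :> N;
  submod_valP : submod_val \in submod_pred K
}.

HB.instance Definition _ := [isSub for submod_val].
HB.instance Definition _ := [Choice of submodType by <:].
HB.instance Definition _ := [SubChoice_isSubLmodule of submodType by <:].

End submodule_type.

Section quotient_modules.
Local Open Scope quotient_scope.
Context (k : pzRingType) (N : lmodType k) (K : submod N).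

Definition quotmod : Type := Quotient.quot (submod_pred K).

HB.instance Definition _ := EqQuotient.on quotmod.
HB.instance Definition _ := GRing.Zmodule.on quotmod.

Lemma quotmodP (x y : N) :
  \pi_quotmod x = \pi_quotmod y <-> submod_set K (x - y).
Proof.
split=> [/eqP|Kxy]; first by rewrite -Quotient.idealrBE => /asboolP.
by apply/eqP; rewrite -Quotient.idealrBE; apply/asboolP.
Qed.

Lemma pi_quotmodD (x y : N) :
  \pi_quotmod (x + y) = \pi_quotmod x + \pi_quotmod y.
Proof. exact: (raddfD (\pi_(Quotient.quot (submod_pred K)))). Qed.

Definition quotmod_scale (a : k) (x : quotmod) : quotmod :=
  \pi_quotmod (a *: repr x).

Lemma quotmod_scale_pi a (x : N) :
  quotmod_scale a (\pi_quotmod x) = \pi_quotmod (a *: x).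
Proof.
apply/quotmodP; rewrite -scalerBr; apply: submoduleZ (submodP K) _.
by apply/quotmodP; rewrite reprK.
Qed.

Lemma quotmod_scaleA a b x :
  quotmod_scale a (quotmod_scale b x) = quotmod_scale (a * b) x.
Proof.
rewrite -[x]reprK [quotmod_scale b _]quotmod_scale_pi.
by rewrite !quotmod_scale_pi scalerA.
Qed.

Lemma quotmod_scale1 : left_id 1 quotmod_scale.
Proof. by move=> x; rewrite -[x]reprK quotmod_scale_pi scale1r. Qed.

Lemma quotmod_scaleDr : right_distributive quotmod_scale +%R.
Proof.
move=> a x y; rewrite -[x]reprK -[y]reprK -pi_quotmodD !quotmod_scale_pi.
by rewrite scalerDr pi_quotmodD.
Qed.

Lemma quotmod_scaleDl x : {morph quotmod_scale^~ x : a b / a + b}.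
Proof.
by move=> a b; rewrite -[x]reprK !quotmod_scale_pi scalerDl pi_quotmodD.
Qed.

HB.instance Definition _ := GRing.Zmodule_isLmodule.Build k quotmod
  quotmod_scaleA quotmod_scale1 quotmod_scaleDr quotmod_scaleDl.

Definition quotmod_pi (x : N) : quotmod := \pi_quotmod x.

Lemma quotmod_pi_linear : linear quotmod_pi.
Proof. by move=> a x y; rewrite /quotmod_pi pi_quotmodD -quotmod_scale_pi. Qed.

HB.instance Definition _ :=
  GRing.isLinear.Build k N quotmod *:%R quotmod_pi quotmod_pi_linear.

End quotient_modules.

Lemma nbhs_subr (G : topGroupType) (c x : G) (U : set G) :
  nbhs (x - c) U -> nbhs x [set y | U (y - c)].
Proof.
move=> /(@addr_continuous G (x, - c))[[V W] /= [xV /nbhs_singleton cW] VWU].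
by apply: filterS xV => y Vy; exact: (VWU (y, - c)).
Qed.

Section quotient_linear_topology.
Context (k : linTopRingType) (N : linTopModType k) (K : submod N).

Definition topquot : Type := quotmod K.

HB.instance Definition _ := GRing.Lmodule.on topquot.

Definition topquot_pi (x : N) : topquot := quotmod_pi K x.

Lemma topquot_pi_linear : linear topquot_pi.
Proof. exact: (linearP (quotmod_pi K)). Qed.

HB.instance Definition _ :=
  GRing.isLinear.Build k N topquot *:%R topquot_pi topquot_pi_linear.

Local Notation pi := topquot_pi.

Definition topquot_open (U : set topquot) := open (pi @^-1` U).

Lemma topquot_openT : topquot_open setT. Proof. exact: openT. Qed.

Lemma topquot_openI : setI_closed topquot_open.
Proof. by move=> A B; exact: openI. Qed.

Lemma topquot_open_bigU (I : Type) (f : I -> set topquot) :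
  (forall i, topquot_open (f i)) -> topquot_open (\bigcup_i f i).
Proof. by move=> fo; apply: bigcup_open => i _; exact: fo. Qed.

HB.instance Definition _ := isOpenTopological.Build topquot
  topquot_openT topquot_openI topquot_open_bigU.

Lemma topquot_pi_cont : continuous pi. Proof. exact/continuousP. Qed.

Lemma topquot_pi_surj (x : topquot) : exists u, x = pi u.
Proof. by exists (repr (x : quotmod K)); rewrite /pi /quotmod_pi reprK. Qed.

Lemma topquot_pi_nbhs u (U : set N) : nbhs u U -> nbhs (pi u) (pi @` U).
Proof.
rewrite nbhsE => -[B [oB Bu] BU].
apply: (@filterS _ _ _ (pi @` B)); first exact: image_subset.
apply: open_nbhs_nbhs; split; last by exists u.
suff : open (pi @^-1` (pi @` B)) by [].
rewrite openE => z [b Bb bz].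
have : nbhs z [set y | B (y - (z - b))].
  by apply: nbhs_subr; rewrite subKr; exact: open_nbhs_nbhs.
apply: filterS => y By; exists (y - (z - b)) => //.
by rewrite !raddfB /= -bz subrr addr0.
Qed.

Lemma topquot_add : continuous (fun x : topquot * topquot => x.1 + x.2).
Proof.
move=> [x y] A.
have [u ->] := topquot_pi_surj x; have [v ->] := topquot_pi_surj y.
rewrite /= -raddfD => /topquot_pi_cont.
move=> /(@addr_continuous N (u, v))[[U V] /= [uU vV] UV].
exists (pi @` U, pi @` V); first by split; exact: topquot_pi_nbhs.
by move=> [_ _] /= [[a Ua <-] [b Vb <-]]; rewrite -raddfD; exact: (UV (a, b)).
Qed.

Lemma topquot_opp : continuous (-%R : topquot -> topquot).
Proof.
move=> x A; have [u ->] := topquot_pi_surj x.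
rewrite -raddfN => /topquot_pi_cont /oppr_continuous /topquot_pi_nbhs.
by apply: filterS => _ [a Aa <-]; rewrite /= -raddfN.
Qed.

HB.instance Definition _ :=
  isTopologicalGroup.Build topquot topquot_add topquot_opp.

Lemma topquot_scale (a : k) : continuous (fun m : topquot => a *: m).
Proof.
move=> x A; have [u ->] := topquot_pi_surj x.
rewrite -linearZ => /topquot_pi_cont /scaler_continuous /topquot_pi_nbhs.
by apply: filterS => _ [b Ab <-]; rewrite /= -linearZ.
Qed.

Lemma topquot_nbhs0 (U : set topquot) : nbhs (0 : topquot) U ->
  exists P : set topquot,
    [/\ submodule P, nbhs (0 : topquot) P & P `<=` U].
Proof.
rewrite -(raddf0 pi) => /topquot_pi_cont /nbhs0_submodule[P [sP P0 PU]].
exists (pi @` P); split; [split| |].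
- by exists 0; [exact: submodule0|rewrite raddf0].
- move=> _ _ [x Px <-] [y Py <-]; exists (x + y); first exact: submoduleD.
  by rewrite raddfD.
- move=> a _ [x Px <-]; exists (a *: x); first exact: submoduleZ.
  by rewrite linearZ.
- exact: topquot_pi_nbhs.
- by move=> _ [x /PU ? <-].
Qed.

HB.instance Definition _ := isLinearlyTopologizedModule.Build k (topquot)
  topquot_scale topquot_nbhs0.

End quotient_linear_topology.

(* The separated completion lim N/P (P ranging over the open submodules of N):
   a point is a family of representatives x_P with x_P = x_Q mod Q whenever P
   is contained in Q, modulo the families with x_P in P for all P. The open
   submodules are the kernels of the projections to the N/P. *)
Section completion.
Context (k : linTopRingType) (N : linTopModType k).

Record opensub := OpenSub {
  opensub_set : set N;
  opensubP : open_submodule opensub_set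
}.

Lemma opensub_submodule (P : opensub) : submodule (opensub_set P).
Proof. by case: P => P []. Qed.

Definition opensubT := OpenSub (@open_submodule_setT k N).

Definition opensubI (P Q : opensub) :=
  OpenSub (open_submoduleI (opensubP P) (opensubP Q)).

Definition coherent : set (opensub -> N) :=
  [set x | forall P Q, opensub_set P `<=` opensub_set Q ->
                       opensub_set Q (x P - x Q)].

Lemma coherent_submodule : submodule coherent.
Proof.
split=> [P Q _|x y xc yc P Q PQ|a x xc P Q PQ].
- by rewrite subrr; exact: submodule0 (opensub_submodule Q).
- rewrite opprD addrACA.
  exact: submoduleD (opensub_submodule Q) (xc _ _ PQ) (yc _ _ PQ).
- by rewrite -scalerBr; exact: submoduleZ (opensub_submodule Q) (xc _ _ PQ).
Qed.

Definition cauchy_family := submodType (Submod coherent_submodule).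

Definition null_families : set cauchy_family :=
  [set x | forall P, opensub_set P (submod_val x P)].

Lemma null_submodule : submodule null_families.
Proof.
split=> [P|x y xn yn P|a x xn P].
- exact: submodule0 (opensub_submodule P).
- exact: submoduleD (opensub_submodule P) (xn P) (yn P).
- exact: submoduleZ (opensub_submodule P) (xn P).
Qed.

Definition compl_mod := quotmod (Submod null_submodule).

Definition compl_pi : {linear cauchy_family -> compl_mod} :=
  quotmod_pi (Submod null_submodule).

Definition compl_nbhs (P : opensub) : set compl_mod :=
  compl_pi @` [set x | opensub_set P (submod_val x P)].

Lemma compl_sub A : range compl_nbhs A -> submodule A.
Proof.
move=> [P _ <-]; split.
- exists 0; last exact: raddf0.
  exact: submodule0 (opensub_submodule P).
- move=> _ _ [x Px <-] [y Py <-]; exists (x + y); last exact: raddfD.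
  exact: submoduleD (opensub_submodule P) Px Py.
- move=> a _ [x Px <-]; exists (a *: x); last exact: linearZ.
  exact: submoduleZ (opensub_submodule P) Px.
Qed.

Lemma compl_neq0 : range compl_nbhs !=set0.
Proof. by exists (compl_nbhs opensubT); exists opensubT. Qed.

Lemma compl_nbhsS (P Q : opensub) :
  opensub_set P `<=` opensub_set Q -> compl_nbhs P `<=` compl_nbhs Q.
Proof.
move=> PQ _ [x Px <-]; exists x => //=.
have /asboolP/= /(_ P Q PQ) xPQ := submod_valP x.
rewrite -(subrK (submod_val x P) (submod_val x Q)) -opprB.
apply: (submoduleD (opensub_submodule Q)); last exact: PQ.
exact: submoduleN (opensub_submodule Q) xPQ.
Qed.

Lemma compl_dir A B : range compl_nbhs A -> range compl_nbhs B ->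
  exists2 C, range compl_nbhs C & C `<=` A `&` B.
Proof.
move=> [P _ <-] [Q _ <-]; exists (compl_nbhs (opensubI P Q)).
  by exists (opensubI P Q).
by move=> z PQz; split; apply: compl_nbhsS PQz => x [].
Qed.

Definition compl_basis : submod_basis compl_mod :=
  SubmodBasis compl_sub compl_neq0 compl_dir.

Definition completion : Type := topmod compl_basis.

HB.instance Definition _ := LinTopMod.copy completion (topmod compl_basis).

Lemma const_coherent (n : N) :
  (fun=> n) \in submod_pred (Submod coherent_submodule).
Proof.
apply/asboolP => P Q _ /=; rewrite subrr.
exact: submodule0 (opensub_submodule Q).
Qed.

Definition compl_inj (n : N) : completion :=
  compl_pi (SubmodElt (const_coherent n)).

Lemma compl_inj_linear : linear compl_inj.
Proof.
move=> a x y; rewrite /compl_inj.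
have -> : SubmodElt (const_coherent (a *: x + y)) =
  a *: SubmodElt (const_coherent x) + SubmodElt (const_coherent y).
  exact: val_inj.
exact: (linearP compl_pi).
Qed.

HB.instance Definition _ :=
  GRing.isLinear.Build k N completion *:%R compl_inj compl_inj_linear.

End completion.

Lemma nbhs_open_submodule (k : linTopRingType) (M : linTopModType k) (y : M)
    (A : set M) :
  nbhs y A <-> exists2 V, open_submodule V & [set x | V (x - y)] `<=` A.
Proof.
split=> [|[V [sV oV] VA]]; last first.
  apply: filterS VA _; apply: nbhs_subr; rewrite subrr.
  by apply: open_nbhs_nbhs; split=> //; exact: submodule0.
rewrite -{1}(add0r y) => /(@addr_continuous M (0, y))[[U W] /= [U0 Wy] UWA].
have [V oV VU] := nbhs0_open_submodule U0; exists V => // x Vxy.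
rewrite -(subrK y x); apply: (UWA (_, _)).
by split; [exact: VU|exact: nbhs_singleton Wy].
Qed.

Section extension.
Context (k : linTopRingType) (N M : linTopModType k).

(* The trace on N of the neighbourhoods of z; it is a proper filter since the
   image of N in its completion is dense. *)
Definition compl_trace (z : completion N) : set_system N :=
  filter_from (nbhs z) (fun W => @compl_inj k N @^-1` W).

(* The extension by continuity: the limit of f n as the image of n tends to z.
   It is meaningful for M separated and complete. *)
Definition extend (f : N -> M) (z : completion N) : M :=
  xget 0 [set y | f @ compl_trace z --> y].

Context (f : {linear N -> M}).
Context (fcont : continuous f) (Msep : hausdorff_space M)
  (Mcomplete : group_complete M).

Local Notation iota := (@compl_inj k N).
Local Notation nbh := (@compl_nbhs k N).

Lemma compl_nbhsE (z : completion N) W :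
  nbhs z W <-> exists P, [set w | nbh P (w - z)] `<=` W.
Proof.
split=> [[_ [P _ <-] PW]|[P PW]]; first by exists P.
by exists (nbh P) => //; exists P.
Qed.

Lemma compl_nbhs_submodule P : submodule (nbh P).
Proof. by apply: (@basis_submodule _ _ (compl_basis N)); exists P. Qed.

Lemma compl_nbhs_inj P n : nbh P (iota n) -> opensub_set P n.
Proof.
move=> [x /= Px /quotmodP /= /(_ P) /= xn].
have := submoduleB (opensub_submodule P) Px xn; rewrite /=.
by rewrite opprB addrC subrK.
Qed.

Lemma compl_inj_dense (z : completion N) P : exists n, nbh P (iota n - z).
Proof.
have [x zx] : exists x : cauchy_family N, z = compl_pi N x.
  by exists (repr (z : compl_mod N)); rewrite /compl_pi /= /quotmod_pi reprK.
exists (submod_val x P); rewrite zx /compl_inj -(raddfB (compl_pi N)).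
eexists; last by reflexivity.
suff : opensub_set P (submod_val x P - submod_val x P) by [].
by rewrite subrr; exact: submodule0 (opensub_submodule P).
Qed.

Lemma extend_contP V : open_submodule V ->
  exists P : opensub N, forall n, opensub_set P n -> V (f n).
Proof.
move=> [sV oV]; have : nbhs (f 0) V.
  by rewrite raddf0; apply: open_nbhs_nbhs; split=> //; exact: submodule0.
by move=> /fcont /nbhs0_open_submodule[P oP PV]; exists (OpenSub oP).
Qed.

Lemma compl_trace_proper z : ProperFilter (compl_trace z).
Proof.
apply: filter_from_proper => [|W /compl_nbhsE[P PW]].
  apply: filter_from_filter => [|U W zU zW].
    by exists setT; exact: filterT.
  by exists (U `&` W) => //; exact: filterI.
by have [n zn] := compl_inj_dense z P; exists n; exact: PW.
Qed.

Lemma extend_cvg z : f @ compl_trace z --> extend f z.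
Proof.
rewrite /extend; apply: (@xgetPex _ _ [set y | f @ compl_trace z --> y]).
have FF := fmap_proper_filter f (compl_trace_proper z).
apply: (Mcomplete FF) => U /nbhs0_open_submodule[V oV VU].
have [P PV] := extend_contP oV.
exists (f @` (iota @^-1` [set w | nbh P (w - z)])).
  exists [set w | nbh P (w - z)]; first by apply/compl_nbhsE; exists P.
  by move=> n ?; exists n.
move=> _ _ [m mz <-] [n nz <-]; apply: VU; rewrite -raddfB; apply: PV.
apply: compl_nbhs_inj; rewrite raddfB.
have -> : iota m - iota n = (iota m - z) - (iota n - z).
  by rewrite opprB addrA subrK.
exact: submoduleB (compl_nbhs_submodule P) mz nz.
Qed.

Lemma extendP z V P : open_submodule V -> exists2 n,
  nbh P (iota n - z) & V (f n - extend f z).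
Proof.
move=> oV.
have /extend_cvg[W /compl_nbhsE[Q QW] WV] :
    nbhs (extend f z) [set y | V (y - extend f z)].
  by apply/nbhs_open_submodule; exists V.
have [n nz] := compl_inj_dense z (opensubI P Q); exists n.
  by apply: compl_nbhsS nz => ? [].
by apply: WV; apply: QW; apply: compl_nbhsS nz => ? [].
Qed.

Lemma extend_linear : linear (extend f).
Proof.
move=> a z w; set y := RHS.
have FF := fmap_proper_filter f (compl_trace_proper (a *: z + w)).
apply: (@cvg_unique _ Msep _ FF); first exact: extend_cvg.
move=> A /nbhs_open_submodule[V oV VA].
have [P PV] := extend_contP oV; have sV := oV.1.
have sP := compl_nbhs_submodule P.
have [m mz Vm] := extendP z P oV; have [n nw Vn] := extendP w P oV.
exists [set u | nbh P (u - (a *: z + w))]; first by apply/compl_nbhsE; exists P.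
move=> l /= lzw; apply: VA => /=.
have /compl_nbhs_inj /PV : nbh P (iota (l - (a *: m + n))).
  have -> : iota (l - (a *: m + n)) =
      (iota l - (a *: z + w)) - (a *: (iota m - z) + (iota n - w)).
    have aux (G : zmodType) (u v w1 w2 t1 : G) :
        u - (v + t1) = (u - (w1 + w2)) - ((v - w1) + (t1 - w2)).
      by rewrite addrACA -[- w1 - w2]opprD opprB addrA subrK.
    rewrite raddfB /= (linearP (@compl_inj k N)) scalerBr; exact: aux.
  apply: submoduleB => //; apply: submoduleD => //; exact: submoduleZ.
rewrite raddfB /= (linearP f) => Vl.
have -> : f l - y = (f l - (a *: f m + f n)) +
    (a *: (f m - extend f z) + (f n - extend f w)).
  have aux (G : zmodType) (u v w1 w2 t1 : G) :
      u - (w1 + w2) = (u - (v + t1)) + ((v - w1) + (t1 - w2)).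
    by rewrite [(v - w1) + _]addrACA -[- w1 - w2]opprD addrA subrK.
  by rewrite scalerBr; exact: aux.
by apply: submoduleD => //; apply: submoduleD => //; exact: submoduleZ.
Qed.

End extension.

Section coimage.
Context (k : linTopRingType) (M : linTopModType k).

Definition forget (B : submod_basis M) (x : topmod B) : M := x.

Lemma forget_linear B : linear (@forget B). Proof. by []. Qed.

HB.instance Definition _ B :=
  GRing.isLinear.Build k (topmod B) M *:%R (@forget B) (@forget_linear B).

Lemma forget_naive_continuous :
  uniform_module M -> continuous (@forget (naive_basis M)).
Proof.
move=> Mu x A /nbhs_open_submodule[V oV VA]; have [I oI IV] := Mu V oV.
exists (ideal_smul I [set: M]); first by exists I.
by move=> y Iy; apply: VA; exact: IV.
Qed.

Section sigma.

(* The continuous extension of the identity of M; the proof argument only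
   serves to make it canonically linear. *)
Definition sigma (_ : clmu M) : completion (naive M) -> M :=
  extend (@forget (naive_basis M)).

Context (hM : clmu M).

Lemma sigma_linear : linear (sigma hM).
Proof.
have [Msep Mcomplete Munif] := hM; apply: extend_linear => //.
exact: forget_naive_continuous.
Qed.

HB.instance Definition _ := GRing.isLinear.Build k (completion (naive M)) M
  *:%R (sigma hM) sigma_linear.

Lemma sigma_ker_submodule : submodule [set x | sigma hM x = 0].
Proof.
split=> [|x y /= x0 y0|a x /= x0]; first exact: raddf0.
- by rewrite raddfD /= x0 y0 addr0.
- by rewrite linearZ /= x0 scaler0.
Qed.

Definition sigma_ker : submod (completion (naive M)) :=
  Submod sigma_ker_submodule.

(* The coimage of sigma, and the canonical map onto it. *)
Definition max_module : Type := completion (topquot sigma_ker).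

HB.instance Definition _ :=
  LinTopMod.copy max_module (completion (topquot sigma_ker)).

Definition coim : completion (naive M) -> max_module :=
  @compl_inj k (topquot sigma_ker) \o @topquot_pi k _ sigma_ker.

HB.instance Definition _ := GRing.Linear.copy coim
  (@compl_inj k (topquot sigma_ker) \o @topquot_pi k _ sigma_ker).

End sigma.

End coimage.

(* For linear f, f is an isomorphism of topological modules. *)
Definition homeomorphic_iso (X Y : topologicalType) (f : X -> Y) : Prop :=
  continuous f /\
  exists g : Y -> X, [/\ continuous g, cancel f g & cancel g f].

Section comparison.
Context (k : linTopRingType) (M : lmodType k).
Implicit Types B C : submod_basis M.

Definition finer B C : Prop :=
  continuous ((fun x => x) : topmod B -> topmod C).

Definition same_topology B C : Prop :=
  forall U : set M, @open (topmod B) U <-> @open (topmod C) U.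

(* Maximality of B among the structures of an object of the category of
   separated complete uniform modules on the given k-module, a finer topology
   being larger. *)
Definition maximal_clmu B : Prop :=
  clmu (topmod B) /\
  forall C, clmu (topmod C) -> finer C B -> finer B C.

End comparison.

(* Main.v *)
(* By uniformity, series whose terms lie in [I n *: M], for [I n] a decreasing
   basis of open ideals of [k], converge in [M].  A gliding hump then shows that
   a closed sponge [P] contains [I *: (J *: M)] for some open ideals [I] and
   [J]; as [P] is closed and [k] is clop, it contains the closure of [L *: M]
   for an open ideal [L] inside the closure of [I * J].  Hence the barrell, clop
   and pscan topologies coincide.  The completion of the naive topology has a
   countable basis, so its quotient by the kernel of [sigma] is already complete
   and its coimage maps bijectively to [M].  If [k] is fop, a naively Cauchy
   sequence can be thinned so that its differences are combinations
   [\sum_i g_i *: y_i] with [g] generating a given open ideal [I] and the [y_i]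
   small; summing the [y_i] in [M] shows that the sequence converges naively. *)
From HB Require Import structures.
Require Import Defs.
From mathcomp Require Import all_boot all_algebra.
From mathcomp Require Import boolp classical_sets functions filter topology.

Set Implicit Arguments.
Unset Strict Implicit.
Unset Printing Implicit Defensive.

Import GRing.Theory.
Local Open Scope classical_set_scope.
Local Open Scope ring_scope.

(** Both [P] and [R] depend on the stage, so that the requirements may tighten at each step; this is
    how decreasing bases, liftings of Cauchy sequences and the gliding hump are built. *)
Lemma dependent_choice (T : Type) (P : nat -> T -> Prop)
    (R : nat -> T -> T -> Prop) (x0 : T) :
  P 0%N x0 -> (forall n x, P n x -> exists2 y, P n.+1 y & R n x y) ->
  exists s : nat -> T,
    [/\ s 0%N = x0, forall n, P n (s n) & forall n, R n (s n) (s n.+1)].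
Proof.
move=> P0 next.
(* The step function has to be total; where [P] fails its value is arbitrary. *)
have /choice[g gP] (nx : nat * T) :
    exists y, P nx.1 nx.2 -> P nx.1.+1 y /\ R nx.1 nx.2 y.
  have [/next[y Py Ry]|nP] := pselect (P nx.1 nx.2); first by exists y.
  by exists nx.2 => /nP.
pose s := nat_rect (fun=> T) x0 (fun n x => g (n, x)).
have Ps n : P n (s n) by elim: n => //= n IHn; case: (gP (n, s n) IHn).
by exists s; split=> // n; case: (gP (n, s n) (Ps n)).
Qed.

(** * Products of an ideal and a submodule *)

Section ideal_smul.
Context (k : pzRingType) (M : lmodType k).
Implicit Types (I J : set k) (P Q : set M).

Lemma ideal_smul_mem I P a m : I a -> P m -> ideal_smul I P (a *: m).
Proof. by move=> Ia Pm Q [_ IPQ]; apply: IPQ; exists a => //; exists m. Qed.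

Lemma ideal_smul_sub I P Q : submodule Q ->
  (forall a m, I a -> P m -> Q (a *: m)) -> ideal_smul I P `<=` Q.
Proof.
by move=> sQ IPQ x; apply; split=> // _ [a Ia [m Pm <-]]; exact: IPQ.
Qed.

Lemma ideal_smul_submodule I P : submodule (ideal_smul I P).
Proof. exact: submodule_gen_submodule. Qed.

Lemma submodule_sum P (n : nat) (f : 'I_n -> M) :
  submodule P -> (forall i, P (f i)) -> P (\sum_i f i).
Proof.
move=> sP Pf; elim/big_ind: _ => //; first exact: submodule0.
by move=> x y; exact: submoduleD.
Qed.

(** Reduces membership of [c *: m] in [P], for [c] in a generated ideal, to the generators of that
    ideal. *)
Lemma submodule_ann P m : submodule P -> ideal [set a | P (a *: m)].
Proof.
move=> sP; split=> /= [|a b Pa Pb|a b Pb].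
- by rewrite scale0r; exact: submodule0.
- by rewrite scalerDl; exact: submoduleD.
- by rewrite -scalerA; exact: submoduleZ.
Qed.

End ideal_smul.

Lemma ideal_mul_smul_sub (k : pzRingType) (M : lmodType k) (I J : set k)
    (P : set M) m : submodule P ->
  (forall a b, I a -> J b -> P (a *: (b *: m))) ->
  forall c, ideal_mul I J c -> P (c *: m).
Proof.
move=> sP IJP c.
apply: (@ideal_smul_sub k k^o I J _ (submodule_ann m sP)) => a b Ia Jb.
by rewrite /= -scalerA; exact: IJP.
Qed.

Lemma ideal_mul_subr (k : pzRingType) (I J : set k) :
  ideal J -> ideal_mul I J `<=` J.
Proof.
move=> iJ; apply: (@ideal_smul_sub k k^o I J J iJ) => a b _.
exact: (submoduleZ a iJ).
Qed.

(** * Open ideals *)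

Section ring.
Context (k : linTopRingType).

Lemma open_ideal_nbhs (I : set k) a :
  open_ideal I -> nbhs a [set b | I (b - a)].
Proof.
move=> [iI oI]; apply: nbhs_subr; rewrite subrr.
by apply: open_nbhs_nbhs; split=> //; exact: submodule0 iI.
Qed.

Lemma nbhs0_open_ideal (U : set k) :
  nbhs (0 : k) U -> exists2 I, open_ideal I & I `<=` U.
Proof.
move=> /nbhs0_ideal[I [iI I0 IU]]; exists I => //; split=> //.
rewrite openE => x Ix; rewrite /interior.
have : nbhs x [set y | I (y - x)] by apply: nbhs_subr; rewrite subrr.
apply: filterS => y /= Iyx; rewrite -(subrK x y).
exact: (submoduleD iI Iyx Ix).
Qed.

Lemma decreasing_ideal_basis : countable_ideal_basis k ->
  exists u : nat -> set k, [/\ forall n, open_ideal (u n),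
    forall n, u n.+1 `<=` u n &
    forall I, open_ideal I -> exists n, u n `<=` I].
Proof.
move=> [u uo ub].
have [|n I oI|v [_ vo vS]] := @dependent_choice _
  (fun n I => open_ideal I /\ I `<=` u n) (fun _ I J => J `<=` I) (u 0%N).
- by split.
- exists (I `&` u n.+1); last by move=> ? [].
  by split; [exact: open_idealI oI.1 (uo _)|move=> ? []].
exists v; split=> [n|//|I /ub[n nI]]; first by case: (vo n).
by exists n; by apply: subset_trans nI; case: (vo n).
Qed.

End ring.

(** * Linear topologies tested on open submodules; Cauchy sequences and series *)

Section modules.
Context (k : linTopRingType).
Implicit Types M N : linTopModType k.

Lemma open_submodule_nbhs0 M (V : set M) :
  open_submodule V -> nbhs (0 : M) V.
Proof.
by move=> [sV oV]; apply: open_nbhs_nbhs; split=> //; exact: submodule0.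
Qed.

Lemma open_submodule_near M (V : set M) x :
  open_submodule V -> nbhs x [set y | V (y - x)].
Proof. by move=> oV; apply/nbhs_open_submodule; exists V. Qed.

Lemma closure_submoduleP M (P : set M) x : closure P x <->
  forall V, open_submodule V -> exists2 y, P y & V (y - x).
Proof.
split=> [cx V oV|H A /nbhs_open_submodule[V oV VA]].
  by have [y [Py Vy]] := cx _ (open_submodule_near x oV); exists y.
by have [y Py Vy] := H V oV; exists y; split=> //; exact: VA.
Qed.

Lemma open_submodule_closed M (V : set M) : open_submodule V -> closed V.
Proof.
move=> oV x /closure_submoduleP/(_ V oV)[y Vy Vyx].
by rewrite -(subKr y x); apply: submoduleB oV.1 Vy Vyx.
Qed.

Lemma hausdorff_submodP M : hausdorff_space M <->
  forall x : M, (forall V, open_submodule V -> V x) -> x = 0.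
Proof.
split=> [sep x Vx|sep p q pq].
  apply: sep => A B /nbhs_singleton Ax /nbhs0_open_submodule[V oV VB].
  by exists x; split=> //; apply: VB; exact: Vx.
apply/subr0_eq/sep => V oV.
have [z [/= Vp Vq]] :=
  pq _ _ (open_submodule_near p oV) (open_submodule_near q oV).
have -> : p - q = (z - q) - (z - p) by rewrite opprB [RHS]addrC subrKA.
exact: (submoduleB oV.1 Vq Vp).
Qed.

Lemma cvg_submodP M (F : set_system M) {FF : Filter F} x :
  F --> x <-> forall V, open_submodule V -> F [set y | V (y - x)].
Proof.
split=> [Fx V oV|H A /nbhs_open_submodule[V oV VA]].
  exact/Fx/open_submodule_near.
exact: filterS VA (H V oV).
Qed.

Lemma group_completeP M :
  (forall F : set_system M, ProperFilter F -> cauchy_filter F ->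
    exists x : M, forall V, open_submodule V -> F [set y | V (y - x)]) ->
  group_complete M.
Proof.
by move=> H F PF /(H F PF)[x Fx]; exists x; exact: (cvg_submodP _).2.
Qed.

Lemma cauchy_submodP M (F : set_system M) :
  (forall V : set M, open_submodule V ->
    exists2 A, F A & forall x y, A x -> A y -> V (x - y)) ->
  cauchy_filter F.
Proof.
move=> H U /nbhs0_open_submodule[V oV VU]; have [A FA AV] := H V oV.
by exists A => // x y Ax Ay; apply: VU; exact: AV.
Qed.

(** Linearity is a hypothesis on a bare function so as to cover [extend f], whose linearity depends
    on the target being separated and complete. *)
Lemma linear_continuous N M (f : N -> M) : linear f ->
  (forall V, open_submodule V ->
    exists2 W, open_submodule W & forall n, W n -> V (f n)) ->
  continuous f.
Proof.
move=> flin H x A /nbhs_open_submodule[V /H[W oW WV] VA].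
apply/nbhs_open_submodule; exists W => // y /WV fV; apply: VA => /=.
by rewrite addrC -scaleN1r -flin scaleN1r addrC.
Qed.

Lemma uniform_smul M (V : set M) : uniform_module M -> open_submodule V ->
  exists2 I, open_ideal I & forall a m, I a -> V (a *: m).
Proof.
move=> Mu /Mu[I oI IV]; exists I => // a m Ia.
by apply: IV; exact: ideal_smul_mem.
Qed.

(** Uniformity makes [a *: m] continuous in [a], so the condition passes to limits of scalars. *)
Lemma closed_smul_closure M (I : set k) (P : set M) m : uniform_module M ->
  closed P -> (forall a, I a -> P (a *: m)) ->
  forall a, closure I a -> P (a *: m).
Proof.
move=> Mu cP IP a ca; apply: cP; apply/closure_submoduleP => V oV.
have [J oJ JV] := uniform_smul Mu oV.
have [b [Ib Jb]] := ca _ (open_ideal_nbhs a oJ).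
by exists (b *: m); [exact: IP|rewrite -scalerBl; exact: JV].
Qed.

Definition decreasing_submod_basis M (V : nat -> set M) : Prop :=
  [/\ forall n, open_submodule (V n), forall n, V n.+1 `<=` V n
    & forall W, open_submodule W -> exists n, V n `<=` W].

Lemma decreasing_subset (T : Type) (V : nat -> set T) :
  (forall n, V n.+1 `<=` V n) -> forall m n, (m <= n)%N -> V n `<=` V m.
Proof.
move=> VS m n /subnK <-; elim: (n - m)%N => //= i IHi.
exact: subset_trans (VS _) IHi.
Qed.

(** The [V n] eventually enter each open submodule but may fail to be open themselves, as happens
    for [ideal_smul J [set: M]]; hence the distance from the limit to [s n] is only located in the
    closure of [V n]. *)
Lemma series_cvg M (V : nat -> set M) (s : nat -> M) : group_complete M ->
  (forall n, submodule (V n)) -> (forall n, V n.+1 `<=` V n) ->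
  (forall W, open_submodule W -> exists n, V n `<=` W) ->
  (forall n, V n (s n.+1 - s n)) ->
  exists y, forall n, closure (V n) (y - s n).
Proof.
move=> Mc sV VS Vb sVn.
have Vs n m : (n <= m)%N -> V n (s m - s n).
  move=> /subnK <-; elim: (m - n)%N => [|i IHi] /=.
    by rewrite subrr; exact: submodule0.
  rewrite addSn -(subrKA (s (i + n)%N)); apply: (submoduleD (sV n)) => //.
  by apply: (decreasing_subset VS) (sVn _); exact: leq_addl.
have [y sy] : exists y : M, s @ \oo --> y.
  apply: Mc; apply: cauchy_submodP => W oW; have [n nW] := Vb _ oW.
  exists [set s m | m in [set m | (n <= m)%N]].
    by exists n => // m /= nm; exists m.
  move=> _ _ [i ni <-] [j nj <-]; rewrite -(subrKA (s n)) -[s n - _]opprB.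
  by apply: (submoduleB oW.1); apply: nW; exact: Vs.
exists y => n; apply/closure_submoduleP => W oW.
have /cvg_submodP/(_ W oW)[m _ mW] := sy.
(* One index serves both purposes: past [n] for [V n], past [m] for being [W]-close to [y]. *)
exists (s (maxn n m) - s n); first exact: Vs (leq_maxl _ _).
by rewrite opprB addrA subrK; apply: mW; exact: leq_maxr.
Qed.

Lemma cauchy_seq M (V : nat -> set M) (F : set_system M) :
  ProperFilter F -> cauchy_filter F -> (forall n, open_submodule (V n)) ->
  exists A : nat -> set M, [/\ forall n, F (A n), forall n, A n.+1 `<=` A n
    & forall n x y, A n x -> A n y -> V n (x - y)].
Proof.
move=> PF cF oV.
have C n := cF _ (open_submodule_nbhs0 (oV n)).
have [A0 FA0 A0V] := C 0%N.
have [|n B [FB BV]|A [_ Ap AS]] := @dependent_choice _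
  (fun n A => F A /\ forall x y, A x -> A y -> V n (x - y))
  (fun _ A B => B `<=` A) A0.
- by split.
- have [D FD DV] := C n.+1; exists (B `&` D); last by move=> ? [].
  split; first exact: filterI.
  by move=> x y [_ Dx] [_ Dy]; exact: DV.
exists A; split=> // n; by case: (Ap n).
Qed.

Lemma topmod_basis_open (N : lmodType k) (B : submod_basis N) P :
  basis_sets B P -> open_submodule (P : set (topmod B)).
Proof.
move=> BP; have sP := basis_submodule BP; split=> //; rewrite openE => x Px.
exists P => // y /= Pyx; rewrite -(subrK x y).
exact: (submoduleD sP Pyx Px).
Qed.

Lemma topmod_open_basis (N : lmodType k) (B : submod_basis N)
    (V : set (topmod B)) :
  open_submodule V -> exists2 P, basis_sets B P & P `<=` V.
Proof.
move=> /open_submodule_nbhs0[P BP PV]; exists P => // x Px.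
by apply: PV; rewrite /= subr0.
Qed.

Lemma finerP (N : lmodType k) (B C : submod_basis N) :
  (forall P, basis_sets C P -> exists2 Q, basis_sets B Q & Q `<=` P) ->
  finer B C.
Proof.
move=> BC x A [P /BC[Q BQ QP] PA]; exists Q => // y Qy.
by apply: PA; exact: QP.
Qed.

Lemma finer_same (N : lmodType k) (B C : submod_basis N) :
  finer B C -> finer C B -> same_topology B C.
Proof.
by move=> /continuousP BC /continuousP CB U; split=> ?; [exact: CB|exact: BC].
Qed.

Lemma same_finer (N : lmodType k) (B C : submod_basis N) :
  same_topology B C -> finer B C.
Proof. by move=> BC; apply/continuousP => U /BC. Qed.

Lemma same_sym (N : lmodType k) (B C : submod_basis N) :
  same_topology B C -> same_topology C B.
Proof. by move=> BC U; split=> /BC. Qed.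

Lemma same_clmu (N : lmodType k) (B C : submod_basis N) :
  same_topology B C -> clmu (topmod B) -> clmu (topmod C).
Proof.
move=> BC [sep cpl unif]; have CB := same_sym BC; split.
- move=> p q pq; apply: sep => X Y Xp Yq; apply: pq.
    exact: (same_finer CB) Xp.
  exact: (same_finer CB) Yq.
- move=> F PF cF; have [|x Fx] := cpl F PF.
    by move=> U /(same_finer CB); exact: cF.
  by exists x => A /(same_finer BC); exact: Fx.
- by move=> P [sP /BC oP]; exact: unif.
Qed.

End modules.

(** * The separated completion and extension by continuity *)

Section completion.
Context (k : linTopRingType) (N : linTopModType k).

Lemma compl_nbhs_open (P : opensub N) :
  open_submodule (compl_nbhs P : set (completion N)).
Proof. by apply: (@topmod_basis_open _ _ (compl_basis N)); exists P. Qed.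

Lemma completion_open (V : set (completion N)) :
  open_submodule V -> exists P : opensub N, compl_nbhs P `<=` V.
Proof.
by move=> /(@topmod_open_basis _ _ (compl_basis N))[_ [P _ <-] PV]; exists P.
Qed.

(* The cast selects the group and topology that [clmu] derives from the
   [linTopModType] structure. *)
Lemma completion_hausdorff :
  hausdorff_space (completion N : linTopModType k).
Proof.
apply/hausdorff_submodP => z zV.
have [x zx] : exists x : cauchy_family N, z = compl_pi N x.
  by exists (repr (z : compl_mod N)); rewrite /compl_pi /= /quotmod_pi reprK.
rewrite zx -(raddf0 (compl_pi N)); apply/quotmodP; rewrite subr0 => P /=.
have := zV _ (compl_nbhs_open P); rewrite zx => -[y Py /quotmodP/(_ P) yx].
rewrite -(subKr (submod_val y P) (submod_val x P)).
exact: (submoduleB (opensub_submodule P) Py yx).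
Qed.

(** For each [P] the filter has a member [A P] of size [P], and by density some [n P] in [N] is
    [P]-close to all of [A P]. The family of the [n P] is itself the limit point. *)
Lemma completion_complete : group_complete (completion N : linTopModType k).
Proof.
apply: group_completeP => F PF cF.
have /choice[A AP] (P : opensub N) : exists A, F A /\
    forall x y, A x -> A y -> (compl_nbhs P : set (completion N)) (x - y).
  have [A FA AP] := cF _ (open_submodule_nbhs0 (compl_nbhs_open P)).
  by exists A.
have /choice[n nP] (P : opensub N) : exists n, forall z, A P z ->
    (compl_nbhs P : set (completion N)) (compl_inj n - z).
  have [w Aw] := filter_ex (AP P).1; have [n nw] := compl_inj_dense w P.
  exists n => z Az; rewrite -(subrKA w).
  by apply: (submoduleD (compl_nbhs_submodule P)) nw ((AP P).2 _ _ _ _).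
(* Coherence: [n P] and [n Q] are compared through a common point of [A P] and [A Q]. *)
have nc : n \in submod_pred (Submod (@coherent_submodule k N)).
  apply/asboolP => P Q PQ /=; apply: compl_nbhs_inj; rewrite raddfB.
  have [w [PAw QAw]] := filter_ex (filterI (AP P).1 (AP Q).1).
  have -> : compl_inj (n P) - compl_inj (n Q) =
      (compl_inj (n P) - w) - (compl_inj (n Q) - w).
    by rewrite opprB subrKA.
  apply: (submoduleB (compl_nbhs_submodule Q)); last exact: nP.
  by apply: (compl_nbhsS PQ); exact: nP.
pose x : completion N := compl_pi N (SubmodElt nc).
exists x => V oV; have [P PV] := completion_open oV.
apply: filterS (AP P).1 => z Az; apply: PV.
have xn : compl_nbhs P (x - compl_inj (n P)).
  rewrite /x /compl_inj -(raddfB (compl_pi N)).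
  eexists; last by reflexivity.
  suff : opensub_set P (n P - n P) by [].
  by rewrite subrr; exact: submodule0 (opensub_submodule P).
have -> : z - x = - ((x - compl_inj (n P)) + (compl_inj (n P) - z)).
  by rewrite subrKA opprB.
apply: (submoduleN (compl_nbhs_submodule P)).
exact: (submoduleD (compl_nbhs_submodule P) xn (nP _ _ Az)).
Qed.

Lemma completion_uniform :
  uniform_module N -> uniform_module (completion N : linTopModType k).
Proof.
move=> Nu V oV; have [P PV] := completion_open oV.
have [I oI IP] := uniform_smul Nu (opensubP P); exists I => //.
apply: ideal_smul_sub oV.1 _ => a z Ia _; apply: PV.
rewrite -[z](@reprK _ (quotmod (Submod (@null_submodule k N)))).
exists (a *: repr (z : compl_mod N)); last exact: linearZ_LR.
exact: IP.
Qed.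

Lemma completion_clmu : uniform_module N -> clmu (completion N).
Proof.
move=> /completion_uniform; split=> //.
  exact: completion_hausdorff.
exact: completion_complete.
Qed.

Lemma compl_inj_continuous : continuous (@compl_inj k N).
Proof.
apply: linear_continuous => [|V /completion_open[P PV]].
  exact: compl_inj_linear.
exists (opensub_set P); first exact: opensubP.
by move=> n Pn; apply: PV; exists (SubmodElt (const_coherent n)).
Qed.

Lemma compl_inj_opensub (P : opensub N) n :
  compl_nbhs P (compl_inj n) <-> opensub_set P n.
Proof.
by split=> [/compl_nbhs_inj//|Pn]; exists (SubmodElt (const_coherent n)).
Qed.

Lemma completion_basis (V : nat -> set N) : decreasing_submod_basis V ->
  exists W : nat -> set (completion N), decreasing_submod_basis W.
Proof.
move=> [oV VS Vb]; exists (fun n => compl_nbhs (OpenSub (oV n))); split.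
- by move=> n; exact: compl_nbhs_open.
- by move=> n; apply: compl_nbhsS; exact: VS.
- move=> W /completion_open[P PW]; have [n nP] := Vb _ (opensubP P).
  by exists n; apply: subset_trans PW; exact: compl_nbhsS.
Qed.

(** The inverse is the extension of the identity of [N]: some [n] is close to [z] in the completion
    and to [g z] in [N] at once, so [g z] maps to [z]. *)
Lemma compl_inj_iso : hausdorff_space N -> group_complete N ->
  homeomorphic_iso (@compl_inj k N).
Proof.
move=> Nsep Nc; split; first exact: compl_inj_continuous.
have idc : continuous (idfun : N -> N) by move=> x.
have near z P := extendP idc Nc z P (opensubP P).
pose g := extend (idfun : N -> N).
have iK z : compl_inj (g z) = z.
  apply/subr0_eq/(hausdorff_submodP _).1 => [|V /completion_open[P PV]].
    exact: completion_hausdorff.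
  apply: PV; have [n nz ng] := near z P.
  have -> : compl_inj (g z) - z = (compl_inj n - z) - compl_inj (n - g z).
    by rewrite raddfB opprB [RHS]addrC subrKA.
  by apply: (submoduleB (compl_nbhs_submodule P)) nz _; apply/compl_inj_opensub.
have ij : injective (@compl_inj k N).
  move=> x y xy; apply/subr0_eq/(hausdorff_submodP _).1 => // V oV.
  apply: (@compl_nbhs_inj k N (OpenSub oV)); rewrite raddfB /= xy subrr.
  exact: submodule0 (compl_nbhs_submodule _).
exists g; split=> //; last by move=> n; exact: ij.
have glin : linear g by apply: extend_linear.
apply: (@linear_continuous k (completion N) N g glin) => V oV.
exists (compl_nbhs (OpenSub oV)); first exact: compl_nbhs_open.
by move=> z; rewrite -{1}[z]iK => /compl_inj_opensub.
Qed.

Lemma extend_inj (M : linTopModType k) (f : {linear N -> M}) n :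
  continuous f -> hausdorff_space M -> group_complete M ->
  extend f (compl_inj n) = f n.
Proof.
move=> fc Msep Mc; apply/esym/subr0_eq/(hausdorff_submodP _).1 => // V oV.
have [P PV] := extend_contP fc oV.
have [m mn Vm] := extendP fc Mc (compl_inj n) P oV.
have -> : f n - extend f (compl_inj n) =
    (f m - extend f (compl_inj n)) - f (m - n).
  by rewrite raddfB opprB [RHS]addrC subrKA.
apply: (submoduleB oV.1 Vm); apply/PV/compl_nbhs_inj.
by rewrite raddfB.
Qed.

Lemma extend_continuous (M : linTopModType k) (f : {linear N -> M}) :
  continuous f -> hausdorff_space M -> group_complete M ->
  continuous (extend f).
Proof.
move=> fc Msep Mc.
have glin : linear (extend f) by apply: extend_linear.
apply: (@linear_continuous k (completion N) M _ glin) => V oV.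
have [P PV] := extend_contP fc oV.
exists (compl_nbhs P) => [|z Pz]; first exact: compl_nbhs_open.
have [n nz Vn] := extendP fc Mc z P oV.
rewrite -(subKr (f n) (extend f z)); apply: (submoduleB oV.1) Vn.
apply: PV; apply: compl_nbhs_inj; rewrite -(subrK z (compl_inj n)).
exact: (submoduleD (compl_nbhs_submodule P) nz Pz).
Qed.

End completion.

(** * Quotients by a submodule *)

Section quotient.
Context (k : linTopRingType) (N : linTopModType k) (K : submod N).

Local Notation pi := (@topquot_pi k N K).

Definition topquot_repr (y : topquot K) : N := repr (y : quotmod K).

Lemma topquot_reprK : cancel topquot_repr pi.
Proof. by move=> y; rewrite /topquot_pi /quotmod_pi reprK. Qed.

Lemma topquot_pi_eq x y : pi x = pi y <-> submod_set K (x - y).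
Proof. exact: quotmodP. Qed.

Lemma topquot_pi_eq0 x : pi x = 0 <-> submod_set K x.
Proof.
rewrite -(raddf0 pi); split=> [/quotmodP|Kx]; first by rewrite subr0.
by apply/quotmodP; rewrite subr0.
Qed.

Lemma topquot_pre_open (W : set (topquot K)) :
  open_submodule W -> open_submodule (pi @^-1` W).
Proof.
move=> [sW oW]; split=> //; split=> /= [|x y Wx Wy|a x Wx].
- by rewrite raddf0; exact: submodule0.
- by rewrite raddfD; exact: submoduleD.
- by rewrite linearZ; exact: submoduleZ.
Qed.

Lemma topquot_image_open (V : set N) :
  open_submodule V -> open_submodule (pi @` V).
Proof.
move=> oV; have sV := oV.1; split; first split.
- by exists 0; [exact: submodule0|rewrite raddf0].
- move=> _ _ [x Vx <-] [y Vy <-]; exists (x + y); last exact: raddfD.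
  exact: submoduleD.
- move=> a _ [x Vx <-]; exists (a *: x); last exact: linearZ.
  exact: submoduleZ.
rewrite openE => _ [x Vx <-]; apply: topquot_pi_nbhs.
by apply: open_nbhs_nbhs; split=> //; exact: oV.2.
Qed.

Lemma topquot_uniform : uniform_module N -> uniform_module (topquot K).
Proof.
move=> Nu W oW; have [I oI IW] := uniform_smul Nu (topquot_pre_open oW).
exists I => //; apply: ideal_smul_sub oW.1 _ => a y Ia _.
by have [x ->] := topquot_pi_surj y; rewrite -linearZ; exact: IW.
Qed.

(* A Cauchy filter is followed by a Cauchy sequence, whose terms can be lifted
   successively with small differences. *)
Lemma topquot_complete (V : nat -> set N) : decreasing_submod_basis V ->
  group_complete N -> group_complete (topquot K).
Proof.
move=> [oV VS Vb] Nc F PF cF.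
have [A [FA AS AV]] := cauchy_seq PF cF (fun n => topquot_image_open (oV n)).
have [y0 Ay0] := filter_ex (FA 0%N); have [x0 x0y] := topquot_pi_surj y0.
have [|n x Ax|x [_ Ax xV]] := @dependent_choice _ (fun n x => A n (pi x))
  (fun n x y => V n (y - x)) x0.
- by rewrite -x0y.
- have [y Ay] := filter_ex (FA n.+1).
  have [v Vv vE] := AV n _ _ (AS _ _ Ay) Ax.
  exists (x + v); last by rewrite addrAC subrr add0r.
  by rewrite raddfD /= vE addrC subrK.
have [z zx] := series_cvg Nc (fun n => (oV n).1) VS Vb xV.
exists (pi z); apply/cvg_submodP => W oW.
have [n nW] := Vb _ (topquot_pre_open oW).
apply: filterS (FA n) => w Aw; rewrite /= -(subrKA (pi (x n))).
apply: (submoduleD oW.1).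
  by have [v Vv <-] := AV n _ _ Aw (Ax n); exact: nW.
rewrite -opprB; apply: (submoduleN oW.1); rewrite -raddfB.
by apply: nW; apply: open_submodule_closed (oV n) _ (zx n).
Qed.

(** The projection is an open map, so once injective it has a continuous inverse. *)
Lemma topquot_pi_iso : (forall x, submod_set K x -> x = 0) ->
  homeomorphic_iso pi.
Proof.
move=> K0; split; first exact: topquot_pi_cont.
have piI : injective pi.
  move=> x y xy; apply/subr0_eq/K0/topquot_pi_eq0.
  by rewrite raddfB /= xy subrr.
have /choice[g gK] (y : topquot K) : exists x, pi x = y.
  by have [x ->] := topquot_pi_surj y; exists x.
exists g; split=> // [y|x]; last exact: piI.
move=> A /(@topquot_pi_nbhs _ _ K); rewrite gK; apply: filterS => _ [x Ax <-].
by rewrite /= (piI _ _ (gK (pi x))).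
Qed.

End quotient.

Lemma homeomorphic_iso_comp (X Y Z : topologicalType) (f : X -> Y)
    (g : Y -> Z) :
  homeomorphic_iso f -> homeomorphic_iso g -> homeomorphic_iso (g \o f).
Proof.
move=> [fc [f' [f'c fK f'K]]] [gc [g' [g'c gK g'K]]]; split.
  by move=> x; apply: continuous_comp; [exact: fc|exact: gc].
exists (f' \o g'); split; [|exact: can_comp|exact: can_comp].
by move=> x; apply: continuous_comp; [exact: g'c|exact: f'c].
Qed.

(** * Closed sponges, and the coincidence of the three topologies *)

Section barrels.
Context (k : linTopRingType) (M : linTopModType k).

Lemma pscan_sets_barrell P : pscan_sets P -> barrell_sets (P : set M).
Proof.
move=> PP; split; first exact: pscan_sets_submodule.
  by case: PP => I _ <-; exact: closed_closure.
move=> m; case: PP => I oI <-; exists I => // a Ia.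
by apply: subset_closure; exact: ideal_smul_mem.
Qed.

Hypothesis hM : clmu M.

Lemma open_submodule_barrell (V : set M) : open_submodule V -> barrell_sets V.
Proof.
have [_ _ Mu] := hM => oV; split.
- exact: oV.1.
- exact: open_submodule_closed.
- by move=> m; have [I oI IV] := uniform_smul Mu oV; exists I => // a /IV.
Qed.

Hypothesis k_countable : countable_ideal_basis k.

(* Gliding hump: otherwise there is a convergent series with sum [y] and
   scalars [a n] tending to 0 such that [a n *: y] never lies in [P]. *)
Lemma barrell_absorbs (P : set M) : barrell_sets P ->
  exists I J, [/\ open_ideal I, open_ideal J
    & forall a m, I a -> ideal_smul J [set: M] m -> P (a *: m)].
Proof.
have [_ Mc Mu] := hM; move=> [sP cP spP]; apply: contrapT => noIJ.
have [u uo ub] := k_countable.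
pose V (J : set k) := ideal_smul J [set: M].
have sV J : submodule (V J) by exact: ideal_smul_submodule.
(* A state is a partial sum together with an ideal bounding all later terms. The last clause keeps
   [a *: y] out of [P] whatever those terms are. *)
pose R n (x y : M * set k) := [/\ y.2 `<=` x.2, y.2 `<=` u n,
  V x.2 (y.1 - x.1) &
  exists2 a, u n a & forall t, closure (V y.2) t -> ~ P (a *: (y.1 + t))].
have [|n [s J] /= oJ|x [_ oJ xR]] := @dependent_choice _
  (fun _ (x : M * set k) => open_ideal x.2) R (0, setT).
- exact: open_ideal_setT.
- have [a [m [ua Jm nPam]]] :
      exists a m, [/\ u n a, V J m & ~ P (a *: m)].
    apply: contrapT => H; apply: noIJ; exists (u n), J; split=> // a m ua Jm.
    by apply: contrapT => nP; apply: H; exists a, m.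
  (* If [a *: s] lies in [P], adding [m] drives it out; otherwise [s] is kept. *)
  have [s' [Js' nPs']] : exists s', V J (s' - s) /\ ~ P (a *: s').
    have [Ps|nPs] := pselect (P (a *: s)).
      exists (s + m); rewrite addrAC subrr add0r; split=> // Psm; apply: nPam.
      have := submoduleB sP Psm Ps.
      by rewrite scalerDr addrAC subrr add0r.
    by exists s; rewrite subrr; split=> //; exact: submodule0.
  have [W oW WP] : exists2 W, open_submodule W &
      forall y, P y -> ~ W (y - a *: s').
    apply: contrapT => H; apply/nPs'/cP/closure_submoduleP => W oW.
    apply: contrapT => H'; apply: H; exists W => // y Py Wy.
    by apply: H'; exists y.
  have [I oI IW] := Mu _ oW.
  (* The three factors make the ideals decrease, make the series converge, and keep later
     corrections inside [W], too small to return to [P]. *)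
  exists (s', J `&` u n `&` I).
    by apply: open_idealI => //; apply: open_idealI.
  split=> /=; [by move=> ? [[]]|by move=> ? [[]]|by []|exists a => // t ct Pt].
  apply: (WP _ Pt); rewrite scalerDr addrAC subrr add0r.
  apply: (submoduleZ a oW.1); apply: (open_submodule_closed oW).
  apply: closureS ct; apply: subset_trans IW.
  by apply: ideal_smulS => // ? [].
have VS n : V (x n.+1).2 `<=` V (x n).2.
  by apply: ideal_smulS => //; case: (xR n).
have [|n||W oW|n|y yx] :=
  @series_cvg _ M (fun n => V (x n).2) (fun n => (x n).1).
- exact: Mc.
- exact: sV.
- exact: VS.
(* The shift comes from [R n], which puts the ideal of stage [n.+1] inside [u n]. *)
- have [I oI IW] := Mu _ oW; have [n nI] := ub _ oI; exists n.+1.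
  apply: subset_trans IW; apply: ideal_smulS => //.
  by apply: subset_trans nI; case: (xR n).
- by case: (xR n).
(* As [P] is a sponge, it contains [a *: y] for every [a] in some [u n]; the scalar chosen at that
   stage contradicts this. *)
have [I oI IP] := spP y; have [n nI] := ub _ oI.
have [_ _ _ [a ua aP]] := xR n; apply: (aP _ (yx n.+1)).
by rewrite addrC subrK; apply/IP/nI.
Qed.

Hypothesis k_clop : clop k.

(** The scalars carrying a given [m] into [P] contain the product of [I] and [J], hence its closure,
    which is open because [k] is clop. *)
Lemma ideal_mul_barrell (I J : set k) (P : set M) :
  open_ideal I -> open_ideal J -> submodule P -> closed P ->
  (forall a m, I a -> ideal_smul J [set: M] m -> P (a *: m)) ->
  exists2 L, open_ideal L & ideal_smul L [set: M] `<=` P.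
Proof.
have [_ _ Mu] := hM; move=> oI oJ sP cP IJP.
have [|L oL LIJ] := @nbhs0_open_ideal k (closure (ideal_mul I J)).
  apply: open_nbhs_nbhs; split; first exact: k_clop.
  by apply: subset_closure; case: (@ideal_smul_submodule k k^o I J).
exists L => //; apply: ideal_smul_sub => // c m /LIJ Lc _.
apply: (closed_smul_closure Mu cP) Lc.
apply: ideal_mul_smul_sub => // a b Ia Jb.
by apply: IJP => //; exact: ideal_smul_mem.
Qed.

Lemma barrell_pscan (P : set M) : barrell_sets P ->
  exists2 Q, pscan_sets Q & Q `<=` P.
Proof.
move=> bP; have [I [J [oI oJ IJP]]] := barrell_absorbs bP.
have [sP cP _] := bP.
have [L oL LP] := ideal_mul_barrell oI oJ sP cP IJP.
exists (closure (ideal_smul L [set: M])); first by exists L.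
by rewrite [P](closure_id _).1 //; exact: closureS.
Qed.

Lemma barrell_smul (P : set M) : barrell_sets P ->
  exists2 I, open_ideal I & ideal_smul I [set: M] `<=` P.
Proof.
move=> /barrell_pscan[_ [I oI <-] IP]; exists I => //.
exact: subset_trans (@subset_closure _ _) IP.
Qed.

Lemma barrell_pscan_same : same_topology (barrell_basis M) (pscan_basis M).
Proof.
apply: finer_same; apply: finerP => P /=; last exact: barrell_pscan.
by move=> /pscan_sets_barrell bP; exists P.
Qed.

Lemma clop_pscan_same : same_topology (clop_basis M) (pscan_basis M).
Proof.
have [_ _ Mu] := hM; apply: finer_same; apply: finerP => P /=.
  move=> [I oI <-]; exists (closure (ideal_smul I [set: M])) => //.
  by exists I => //; exists setT => //; exact: open_submodule_setT.
move=> [J oJ [V oV <-]]; have [I oI IV] := Mu _ oV.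
(* Uniformity has put [ideal_smul I [set: M]] inside [V], so [J] carries it into the closure
   considered. *)
have [|||L oL LP] := @ideal_mul_barrell J I (closure (ideal_smul J V)) oJ oI.
- exact/closure_submodule/ideal_smul_submodule.
- exact: closed_closure.
- by move=> a m Ja /IV Vm; apply: subset_closure; exact: ideal_smul_mem.
exists (closure (ideal_smul L [set: M])); first by exists L.
rewrite [closure (ideal_smul J V)](closure_id _).1; last exact: closed_closure.
exact: closureS.
Qed.

Lemma forget_barrell_continuous : continuous (@forget k M (barrell_basis M)).
Proof.
move=> x A /nbhs_open_submodule[V oV VA]; exists V => //.
exact: open_submodule_barrell.
Qed.

(* The barrels are closed in the coarser complete topology of [M]. *)
Lemma barrell_clmu : clmu (barrell M).
Proof.
have [Msep Mc Mu] := hM; split.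
- apply/hausdorff_submodP => x Vx; apply: (hausdorff_submodP M).1 => // V oV.
  by apply: Vx; exact/topmod_basis_open/open_submodule_barrell.
- apply: group_completeP => F PF cF.
  have [|x Fx] := Mc F PF.
    apply: cauchy_submodP => V oV.
    apply: cF; exists V; first exact: open_submodule_barrell.
    by move=> y; rewrite /= subr0.
  have {Fx} Fx := (@cvg_submodP _ M F (@filter_filter _ F PF) x).1 Fx.
  exists x => W /topmod_open_basis[P bP PW].
  have [sP cP _] := bP.
  (* Fix [y] in [A] and let [z] tend to [x] in [M] along the filter: [y - z] stays in [P] and tends
     to [y - x]. *)
  have [A FA AP] := cF _ (open_submodule_nbhs0 (topmod_basis_open bP)).
  apply: filterS (FA) => y Ay; apply: PW; apply: cP.
  apply/closure_submoduleP => V oV.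
  have [z [Vz Az]] := filter_ex (filterI (Fx V oV) FA).
  exists (y - z); first exact: AP.
  by rewrite opprB addrC subrKA -opprB; exact: (submoduleN oV.1).
- move=> W /topmod_open_basis[P bP PW]; have [I oI IP] := barrell_smul bP.
  by exists I => //; exact: subset_trans PW.
Qed.

End barrels.

(** * Completeness of the naive topology over a fop ring *)

Section fop.
Context (k : linTopRingType) (M : linTopModType k).

Lemma fg_smul_sum (g : seq k) (J : set k) m :
  ideal_smul (ideal_mul (ideal_gen [set` g]) J) [set: M] m ->
  exists y : 'I_(size g) -> M, (forall i, ideal_smul J [set: M] (y i)) /\
    m = \sum_(i < size g) g`_i *: y i.
Proof.
pose T : set M := [set m | exists y : 'I_(size g) -> M,
  (forall i, ideal_smul J [set: M] (y i)) /\ m = \sum_(i < size g) g`_i *: y i].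
have sJ : submodule (ideal_smul J [set: M]) by exact: ideal_smul_submodule.
have sT : submodule T.
  split.
  - exists (fun=> 0); split=> [i|]; first exact: submodule0 sJ.
    by rewrite big1 // => i _; rewrite scaler0.
  - move=> _ _ [x [Jx ->]] [y [Jy ->]]; exists (fun i => x i + y i); split.
      by move=> i; exact: (submoduleD sJ (Jx i) (Jy i)).
    by rewrite -big_split; apply: eq_bigr => i _; rewrite scalerDr.
  - move=> a _ [x [Jx ->]]; exists (fun i => a *: x i); split.
      by move=> i; exact: (submoduleZ a sJ (Jx i)).
    rewrite scaler_sumr; apply: eq_bigr => i _.
    by rewrite !scalerA mulrC.
move: m; apply: (ideal_smul_sub sT) => c m Ic _.
apply: ideal_mul_smul_sub Ic => // a b Ia Jb.
apply: (Ia _ (conj (submodule_ann (b *: m) sT) _)) => x /= /(nthP 0)[i ig <-].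
(* All of [b *: m] goes to one position of the generator in [g]. *)
exists (fun j => if j == Ordinal ig then b *: m else 0); split=> [j|].
  by case: ifP => _; [exact: ideal_smul_mem|exact: submodule0 sJ].
rewrite (bigD1 (Ordinal ig)) //= eqxx big1 ?addr0 // => j /negbTE ->.
exact: scaler0.
Qed.

Hypothesis hM : clmu M.

Lemma naive_uniform : uniform_module (naive M).
Proof. by move=> V /topmod_open_basis[_ [I oI <-] IV]; exists I. Qed.

Lemma naive_open (I : set k) :
  open_ideal I -> open_submodule (ideal_smul I [set: M] : set (naive M)).
Proof. by move=> oI; apply: topmod_basis_open; exists I. Qed.

Lemma open_submodule_naive (V : set M) :
  open_submodule V -> open_submodule (V : set (naive M)).
Proof.
have [_ _ Mu] := hM; move=> [sV oV]; split=> //.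
by have /continuousP := forget_naive_continuous Mu; apply.
Qed.

Lemma naive_basis_countable (u : nat -> set k) :
  (forall n, open_ideal (u n)) -> (forall n, u n.+1 `<=` u n) ->
  (forall I, open_ideal I -> exists n, u n `<=` I) ->
  decreasing_submod_basis (fun n => ideal_smul (u n) [set: M] : set (naive M)).
Proof.
move=> uo uS ub; split=> [n|n|W /topmod_open_basis[_ [I oI <-] IW]].
- exact: naive_open.
- exact: ideal_smulS.
- have [n nI] := ub _ oI; exists n; apply: subset_trans IW.
  exact: ideal_smulS.
Qed.

(* A Cauchy sequence whose successive differences lie in
   [\sum_i g_i *: (u n *: M)] has a limit in [M] at distance [\sum_i g_i *: M],
   as the coefficients of the [g_i] can be summed in [M]. *)
Lemma naive_clmu : countable_ideal_basis k -> fop k -> clmu (naive M).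
Proof.
have [Msep Mc Mu] := hM; move=> /decreasing_ideal_basis[u [uo uS ub]].
move=> [kmul kfg]; split; last exact: naive_uniform.
  apply/hausdorff_submodP => x Vx; apply: (hausdorff_submodP M).1 => // V oV.
  by apply: Vx; exact: open_submodule_naive.
apply: group_completeP => F PF cF.
(* The naive topology is finer, so the filter is also Cauchy in [M]; its limit there is the
   candidate. *)
have [|x Fx] := Mc F PF.
  apply: cauchy_submodP => V oV.
  exact/cF/open_submodule_nbhs0/open_submodule_naive.
have {Fx} Fx := (@cvg_submodP _ M F (@filter_filter _ F PF) x).1 Fx.
exists x => W /topmod_open_basis[_ [I0 /kfg[I [oI [g gI] II0]] <-] I0W].
(* The factor [I] supplies the generators [g], the factor [u n] the smallness of their
   coefficients. *)
have oIu n : open_ideal (ideal_mul I (u n)).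
  by split; [exact: (@ideal_smul_submodule k k^o)|exact: kmul].
have [A [FA AS AV]] := cauchy_seq PF cF (fun n => naive_open (oIu n)).
apply: filterS (FA 0%N) => a Aa; apply: I0W.
apply: (ideal_smulS (P := [set: M]) II0) => //.
(* Starting at an arbitrary [a] of [A 0] shows that all of [A 0] is close to [x]. *)
have [|n b Ab|s [s0 As _]] := @dependent_choice M (fun n s => A n s)
  (fun _ _ _ => True) a; first exact: Aa.
  by have [c Ac] := filter_ex (FA n.+1); exists c.
have /choice[y yP] n : exists y : 'I_(size g) -> M,
    (forall i, ideal_smul (u n) [set: M] (y i)) /\
    s n.+1 - s n = \sum_(i < size g) g`_i *: y i.
  by apply: fg_smul_sum; rewrite -gI; apply: AV => //; exact: AS.
have sU n : submodule (ideal_smul (u n) [set: M]).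
  exact: ideal_smul_submodule.
have uM V : open_submodule (V : set M) ->
    exists n, ideal_smul (u n) [set: M] `<=` V.
  move=> oV; have [J oJ JV] := Mu _ oV; have [n nJ] := ub _ oJ; exists n.
  by apply: subset_trans JV; exact: ideal_smulS.
have /choice[Y YP] (i : 'I_(size g)) : exists Y, forall n,
    closure (ideal_smul (u n) [set: M]) (Y - \sum_(m < n) y m i).
  apply: series_cvg => // n; first exact: ideal_smulS.
  by rewrite big_ord_recr /= addrAC subrr add0r; exact: (yP n).1.
have sE n : s n = a + \sum_(i < size g) g`_i *: \sum_(m < n) y m i.
  elim: n => [|n IHn].
    by rewrite s0 big1 ?addr0 // => i _; rewrite big_ord0 scaler0.
  rewrite -(subrK (s n) (s n.+1)) (yP n).2 addrC IHn -addrA -big_split.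
  congr (_ + _); apply: eq_bigr => i _.
  by rewrite big_ord_recr /= scalerDr.
suff -> : a - x = - \sum_(i < size g) g`_i *: Y i.
  have sI := ideal_smul_submodule I [set: M].
  apply: (submoduleN sI); apply: (submodule_sum sI) => i.
  apply: ideal_smul_mem => //; rewrite gI => Q [_]; apply => /=.
  exact: mem_nth.
apply/subr0_eq/(hausdorff_submodP M).1 => // V oV.
have [n nV] := uM _ oV.
have [z [Vz Az]] := filter_ex (filterI (Fx V oV) (FA n)).
(* All three terms lie in [V]: [z] is close to [x], both [z] and [s n] are in [A n], and the tails
   of the coefficient series are small. *)
have -> : a - x - - (\sum_(i < size g) g`_i *: Y i) =
    (z - x) - (z - s n) + \sum_(i < size g) g`_i *: (Y i - \sum_(m < n) y m i).
  under [X in _ = _ + X]eq_bigr do rewrite scalerBr.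
  rewrite big_split /= sumrN sE opprB [z - x + _]addrC subrKA opprK.
  rewrite -!addrA; congr (_ + _); rewrite [RHS]addrCA; congr (_ + _).
  by rewrite addrCA subrr addr0.
apply: (submoduleD oV.1).
  apply: (submoduleB oV.1) => //; apply: nV.
  have := AV n _ _ Az (As n); apply: ideal_smulS => //.
  by apply: ideal_mul_subr; case: (uo n).
apply: (submodule_sum oV.1) => i; apply: (submoduleZ _ oV.1).
apply: (open_submodule_closed oV); apply: closureS (YP i n); exact: nV.
Qed.

End fop.

(** * The map [sigma] and its coimage *)

Section sigma.
Context (k : linTopRingType) (M : linTopModType k) (hM : clmu M).

Let Msep : hausdorff_space M. Proof. by case: hM. Qed.
Let Mc : group_complete M. Proof. by case: hM. Qed.
Let Mu : uniform_module M. Proof. by case: hM. Qed.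

Lemma sigma_inj (m : naive M) : sigma hM (compl_inj m) = m.
Proof.
by rewrite /sigma extend_inj //; exact: forget_naive_continuous.
Qed.

Lemma sigma_continuous : continuous (sigma hM).
Proof. by apply: extend_continuous => //; exact: forget_naive_continuous. Qed.

(** This estimate gives continuity into the pscan topology, and so into the barrell topology, rather
    than only into that of [M]. *)
Lemma sigma_closure (I : set k) (oI : open_ideal I) z :
  compl_nbhs (OpenSub (naive_open M oI)) z ->
  closure (ideal_smul I [set: M]) (sigma hM z).
Proof.
move=> Iz; apply/closure_submoduleP => V oV.
have [n nz Vn] :=
  extendP (forget_naive_continuous Mu) Mc z (OpenSub (naive_open M oI)) oV.
exists n => //; apply: (@compl_nbhs_inj _ _ (OpenSub (naive_open M oI))).
rewrite -(subrK z (compl_inj n)).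
exact: (submoduleD (compl_nbhs_submodule _) nz Iz).
Qed.

Local Notation Q := (topquot (sigma_ker hM)).
Local Notation pi := (@topquot_pi k _ (sigma_ker hM)).

Lemma sigma_eq_pi x y : pi x = pi y -> sigma hM x = sigma hM y.
Proof. by move=> /topquot_pi_eq /= xy; apply/subr0_eq; rewrite -raddfB. Qed.

(** The quotient by the kernel injects continuously into the separated module [M]. *)
Lemma sigma_quot_hausdorff : hausdorff_space (Q : linTopModType k).
Proof.
apply/hausdorff_submodP => y; have [z ->] := topquot_pi_surj y => zW.
apply/topquot_pi_eq0; apply: (hausdorff_submodP M).1 => // V [sV oV].
have oS : open_submodule (sigma hM @^-1` V : set (completion (naive M))).
  split; last by have /continuousP := sigma_continuous; apply.
  split=> /= [|u v Vu Vv|a u Vu].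
  - by rewrite raddf0; exact: submodule0.
  - by rewrite raddfD; exact: submoduleD.
  - by rewrite linearZ; exact: submoduleZ.
by have [x Vx /sigma_eq_pi <-] := zW _ (topquot_image_open (sigma_ker hM) oS).
Qed.

Lemma max_module_clmu : clmu (max_module hM).
Proof.
apply: completion_clmu; apply: topquot_uniform; apply: completion_uniform.
exact: naive_uniform.
Qed.

Lemma coim_continuous : continuous (coim hM).
Proof.
move=> x; apply: continuous_comp; first exact: topquot_pi_cont.
exact: compl_inj_continuous.
Qed.

Hypothesis k_countable : countable_ideal_basis k.

Lemma sigma_quot_complete : group_complete (Q : linTopModType k).
Proof.
have [u [uo uS ub]] := decreasing_ideal_basis k_countable.
have [W Wb] := completion_basis (naive_basis_countable M uo uS ub).
exact: topquot_complete Wb (@completion_complete _ _).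
Qed.

(** The outer completion in [max_module] thus adds no points, whence the surjectivity of [coim]. *)
Lemma quot_max_iso :
  homeomorphic_iso (@compl_inj k Q : Q -> max_module hM).
Proof.
exact: compl_inj_iso sigma_quot_hausdorff sigma_quot_complete.
Qed.

Definition sigma_quot (y : Q) : barrell M :=
  sigma hM (topquot_repr y).

Lemma sigma_quot_pi z : sigma_quot (pi z) = sigma hM z.
Proof. by apply: sigma_eq_pi; rewrite topquot_reprK. Qed.

Lemma sigma_quot_linear : linear sigma_quot.
Proof.
move=> a x y; have [u ->] := topquot_pi_surj x.
have [v ->] := topquot_pi_surj y.
by rewrite -linearP !sigma_quot_pi linearP.
Qed.

HB.instance Definition _ := GRing.isLinear.Build k Q (barrell M)
  *:%R sigma_quot sigma_quot_linear.

Hypothesis k_clop : clop k.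

Lemma sigma_quot_continuous : continuous sigma_quot.
Proof.
apply: (@linear_continuous k Q (barrell M) _ sigma_quot_linear).
move=> V /topmod_open_basis[P bP PV].
have [_ [I oI <-] IP] := barrell_pscan hM k_countable k_clop bP.
exists (pi @` compl_nbhs (OpenSub (naive_open M oI))).
  exact/topquot_image_open/compl_nbhs_open.
by move=> _ [z Iz <-]; apply/PV/IP; rewrite sigma_quot_pi; exact: sigma_closure.
Qed.

Definition max_barrell : max_module hM -> barrell M := extend sigma_quot.

Lemma max_barrell_coim z : max_barrell (coim hM z) = sigma hM z.
Proof.
have [bsep bc _] := barrell_clmu hM k_countable k_clop.
apply: etrans (sigma_quot_pi z).
exact: (extend_inj _ sigma_quot_continuous bsep bc).
Qed.

Lemma max_barrell_linear : linear max_barrell.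
Proof.
have [bsep bc _] := barrell_clmu hM k_countable k_clop.
by apply: extend_linear => //; exact: sigma_quot_continuous.
Qed.

Lemma max_barrell_continuous : continuous max_barrell.
Proof.
have [bsep bc _] := barrell_clmu hM k_countable k_clop.
by apply: extend_continuous => //; exact: sigma_quot_continuous.
Qed.

Lemma coim_surj (w : max_module hM) : exists x, w = coim hM x.
Proof.
have [_ [g [_ _ gK]]] := quot_max_iso.
have [x gx] := topquot_pi_surj (g w).
by exists x; rewrite /coim /= -gx gK.
Qed.

Lemma max_barrell_bij : bijective max_barrell.
Proof.
exists (fun m => coim hM (@compl_inj k (naive M) m)) => [w|m]; last first.
  by rewrite max_barrell_coim sigma_inj.
(* [x] and the image of [sigma hM x] in the completion have the same [sigma], so they agree modulo
   the kernel. *)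
have [x ->] := coim_surj w; rewrite max_barrell_coim /coim /=; congr compl_inj.
apply/topquot_pi_eq => /=; rewrite raddfB /= sigma_inj; exact: subrr.
Qed.

Lemma naive_finer_barrell : finer (naive_basis M) (barrell_basis M).
Proof.
apply: finerP => P /(barrell_smul hM k_countable k_clop)[I oI IP].
by exists (ideal_smul I [set: M]) => //; exists I.
Qed.

End sigma.

(** * Maximality of the naive topology, and the coimage in the fop case *)

Lemma naive_finer (k : linTopRingType) (N : lmodType k) (B : submod_basis N) :
  uniform_module (topmod B) -> finer (naive_basis N) B.
Proof.
move=> Bu; apply: finerP => P /topmod_basis_open/Bu[I oI IP].
by exists (ideal_smul I [set: N]) => //; exists I.
Qed.

(** Uniformity puts every competing topology below the naive one, which is itself a competitor: a
    greatest element is the only maximal one. *)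
Lemma maximal_naive (k : linTopRingType) (N : lmodType k)
    (B : submod_basis N) : clmu (naive N) ->
  maximal_clmu B <-> same_topology B (naive_basis N).
Proof.
move=> hN; split=> [[Bc maxB]|BN].
  have [_ _ /naive_finer NB] := Bc.
  by apply: finer_same => //; exact: maxB.
have NB := same_sym BN; split; first exact: same_clmu NB hN.
move=> C [_ _ /naive_finer NC] _ x A /NC; exact: (same_finer BN).
Qed.

Section fop_sigma.
Context (k : linTopRingType) (M : linTopModType k) (hM : clmu M).
Hypotheses (k_countable : countable_ideal_basis k) (k_fop : fop k).

Lemma naive_compl_iso : homeomorphic_iso (@compl_inj k (naive M)).
Proof.
have [Nsep Nc _] := naive_clmu hM k_countable k_fop.
exact: compl_inj_iso.
Qed.

Lemma coim_iso : homeomorphic_iso (coim hM).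
Proof.
apply: homeomorphic_iso_comp (quot_max_iso hM k_countable).
(* Each [x] comes from [M], where [sigma] is the identity, so the kernel is zero. *)
apply: topquot_pi_iso => x /= x0; have [_ [g [_ _ gK]]] := naive_compl_iso.
rewrite -(gK x); move: x0; rewrite -{1}(gK x) sigma_inj => ->.
exact: (raddf0 (@compl_inj k (naive M))).
Qed.

End fop_sigma.

Theorem theorem5p2p16 (k : linTopRingType)
    (k_separated : hausdorff_space k) (k_complete : group_complete k)
    (k_countable : countable_ideal_basis k) (k_clop : clop k)
    (M : linTopModType k) (hM : clmu M) :
  [/\ [/\ clmu (completion (naive M)), continuous (sigma hM),
          (forall m : naive M, sigma hM (compl_inj m) = m)
        & (forall m : M, exists x, sigma hM x = m)],
      [/\ clmu (max_module hM), clmu (barrell M) & continuous (coim hM)],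
      (exists beta : {linear max_module hM -> barrell M},
        [/\ continuous beta, bijective beta
          & forall x, forget (beta (coim hM x)) = sigma hM x]),
      continuous (@forget k M (barrell_basis M))
    & same_topology (barrell_basis M) (clop_basis M) /\
      same_topology (clop_basis M) (pscan_basis M)] /\
  (fop k ->
    [/\ homeomorphic_iso (coim hM),
        homeomorphic_iso (fun m : naive M => coim hM (compl_inj m)),
        clmu (naive M),
        finer (naive_basis M) (barrell_basis M)
      & (forall B : submod_basis M,
          clmu (topmod B) -> finer (naive_basis M) B) /\
        (forall B : submod_basis M,
          maximal_clmu B <-> same_topology B (naive_basis M))]).
Proof.
have CP := clop_pscan_same hM k_clop.
split; [split|move=> k_fop; split].
- split.
  + exact/completion_clmu/naive_uniform.
  + exact: sigma_continuous.
  + exact: sigma_inj.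
  + by move=> m; exists (@compl_inj k (naive M) m); exact: sigma_inj.
- split; first exact: max_module_clmu.
    exact: barrell_clmu.
  exact: coim_continuous.
- pose beta := HB.pack_for {linear max_module hM -> barrell M}
    (@max_barrell _ _ hM)
    (GRing.isLinear.Build k _ _ _ _ (max_barrell_linear k_countable k_clop)).
  exists beta; split.
  + exact: max_barrell_continuous.
  + exact: max_barrell_bij.
  + exact: max_barrell_coim.
- exact: forget_barrell_continuous.
- split=> // U; have [CPl PCl] := CP U.
  have [BP PB] := barrell_pscan_same hM k_countable k_clop U.
  by split=> [/BP/PCl|/CPl/PB].
- exact: coim_iso.
- apply: homeomorphic_iso_comp (coim_iso hM k_countable k_fop).
  exact: naive_compl_iso.
- exact: naive_clmu.
- exact: naive_finer_barrell.
- split=> B; first by case=> _ _; exact: naive_finer.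
  by apply: maximal_naive; exact: naive_clmu.
Qed.
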